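(* Let $K$ be a field of characteristic different from $2$ and let $X$ be a connected poset such that every multiplicative automorphism of $FI(X,K)$ is inner and every derivation from $FI(X,K)$ to $I(X,K)$ is inner. Let $\lambda$ be an involution on $X$ with no fixed points in $X$. Then the involutions $\widetilde{\rho_\lambda}$, $\widetilde{\rho_\lambda}\circ\widetilde{-\delta}$, $\widetilde{\sigma_\lambda}$ and $\widetilde{\sigma_\lambda}\circ\widetilde{-\delta}$ on $D(X,K)$ are pairwise not equivalent. Furthermore, each involution on $D(X,K)$ that induces $\lambda$ on $X$ is equivalent to one of them.
   Context: For a field $K$ and a poset $X$, the incidence space $I(X,K)$ is the $K$-space of functions $f:X\times X\to K$ with $f(x,y)=0$ whenever $x\nleq y$. The finitary incidence algebra $FI(X,K)$ is the subspace of all $f\in I(X,K)$ such that for all $x\le y$ in $X$ there are only finitely many subintervals $[u,v]\subseteq[x,y]$ with $u\ne v$ and $f(u,v)\neq 0$. It is an associative unital $K$-algebra, with unity $\delta$, under convolution $(fg)(x,y)=\sum_{x\le z\le y}f(x,z)g(z,y)$, and the same formula makes $I(X,K)$ an $FI(X,K)$-bimodule. $D(X,K)$ is the $K$-algebra $FI(X,K)\oplus I(X,K)$, elements written as columns, with multiplication $\begin{bmatrix}f\\ i\end{bmatrix}\begin{bmatrix}g\\ j\end{bmatrix}=\begin{bmatrix}fg\\ fj+ig\end{bmatrix}$. An automorphism of an algebra is inner if it has the form $a\mapsto uau^{-1}$, $u$ a unit. An involution on a $K$-algebra is a $K$-linear anti-automorphism whose square is the identity; an involution on a poset $X$ is a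 bijection $\lambda$ with $x\le y\Leftrightarrow\lambda(y)\le\lambda(x)$ and $\lambda^2=\mathrm{id}$. Involutions $\phi,\varphi$ on a $K$-algebra $A$ are equivalent if $\Psi\circ\phi=\varphi\circ\Psi$ for some $K$-linear automorphism $\Psi$ of $A$. A poset is connected if any two elements are joined by a finite sequence in which consecutive elements are comparable. A multiplicative automorphism of $FI(X,K)$ is a map $M_\sigma(f)(x,y)=\sigma(x,y)f(x,y)$, where $\sigma\in I(X,K)$ satisfies $\sigma(x,y)\neq0$ for all $x\le y$ and $\sigma(x,y)\sigma(y,z)=\sigma(x,z)$ for $x\le y\le z$. A derivation $D:FI(X,K)\to I(X,K)$ is a $K$-linear map with $D(fg)=D(f)g+fD(g)$; it is inner if there is $i\in I(X,K)$ with $D(f)=fi-if$ for all $f$. Let $e_x\in FI(X,K)$ be $1$ at $(x,x)$ and $0$ elsewhere. An involution $\Phi$ on $D(X,K)$ induces the involution $\lambda$ on $X$ such that $\Phi\left(\begin{bmatrix}e_x\\0\end{bmatrix}\right)$ is conjugate to $\begin{bmatrix}e_{\lambda(x)}\\0\end{bmatrix}$ for every $x\in X$. Set $\rho_\lambda(f)(x,y)=f(\lambda(y),\lambda(x))$ for $f\in FI(X,K)$, let $\overline{\rho_\lambda}$ be given by the same formula on $I(X,K)$, and $\widetilde{\rho_\lambda}\left(\begin{bmatrix}f\\ i\end{bmatrix}\right)=\begin{bmatrix}\rho_\lambda(f)\\ \overline{\rho_\lambda}(i)\end{bmatrix}$. Also $\widetilde{-\delta}\left(\begin{bmatrix}f\\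 i\end{bmatrix}\right)=\begin{bmatrix}f\\ -i\end{bmatrix}$. Since $\lambda$ has no fixed points, there is a partition $X=X_1\cup X_2$ into disjoint subsets such that $\lambda$ interchanges $X_1$ and $X_2$, and: if $x\in X_1$ and $y\le x$ then $y\in X_1$; if $x\in X_2$ and $x\le y$ then $y\in X_2$. Fix such a partition. Let $w\in FI(X,K)$ be the diagonal function with $w(x,x)=1$ for $x\in X_1$, $w(x,x)=-1$ for $x\in X_2$, and $w(x,y)=0$ for $x\neq y$. Then $\sigma_\lambda(f)=w\rho_\lambda(f)w^{-1}$ is an involution on $FI(X,K)$, and $\widetilde{\sigma_\lambda}\left(\begin{bmatrix}f\\ i\end{bmatrix}\right)=\begin{bmatrix}w\rho_\lambda(f)w^{-1}\\ w\overline{\rho_\lambda}(i)w^{-1}\end{bmatrix}$. *)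

(* Defs.v *)
From HB Require Import structures.
From mathcomp Require Import all_boot all_order all_algebra.
From mathcomp Require Import boolp classical_sets cardinality functions fsbigop.

Set Implicit Arguments.
Unset Strict Implicit.
Unset Printing Implicit Defensive.

Import Order.TTheory GRing.Theory.

Local Open Scope classical_set_scope.
Local Open Scope ring_scope.

Lemma finite_setUW (T : Type) (A B : set T) :
  finite_set A -> finite_set B -> finite_set (A `|` B).
Proof. by move=> Af Bf; rewrite finite_setU. Qed.

Section IncidenceSpace.
Context {d : Order.disp_t} (X : porderType d) (K : fieldType).

Definition incidence_pred : {pred X -> X -> K} :=
  [pred f | `[< forall x y, ~~ (x <= y)%O -> f x y = 0 >]].

Fact incidence_pred_zmod : zmod_closed incidence_pred.
Proof.
split=> [|f g /asboolP f0 /asboolP g0]; apply/asboolP => // x y xy.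
by rewrite !fctE f0 // g0 // subr0.
Qed.
HB.instance Definition _ :=
  GRing.isZmodClosed.Build (X -> X -> K) incidence_pred incidence_pred_zmod.

Record incidence := Incidence {
  incidence_fun :> X -> X -> K;
  _ : incidence_fun \in incidence_pred }.

HB.instance Definition _ := [isSub for incidence_fun].
HB.instance Definition _ := [Choice of incidence by <:].
HB.instance Definition _ := [SubChoice_isSubZmodule of incidence by <:].

Implicit Types (f g h : X -> X -> K) (i j k : incidence) (x y z : X).

Lemma incidenceP i x y : ~~ (x <= y)%O -> i x y = 0.
Proof. by case: i => i /= /asboolP; apply. Qed.

Lemma incidence_le i x y : i x y != 0 -> (x <= y)%O.
Proof. by apply: contraNT => /incidenceP ->. Qed.

Lemma incidence_ext i j : (forall x y, i x y = j x y) -> i = j.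
Proof. by move=> ij; apply: val_inj; apply/funext => x; apply/funext => y. Qed.

Fact inc_scale_subproof (a : K) i : (fun x y => a * i x y) \in incidence_pred.
Proof. by apply/asboolP => x y /incidenceP ->; rewrite mulr0. Qed.
Definition inc_scale a i := Incidence (inc_scale_subproof a i).

Fact inc_scaleA a b i : inc_scale a (inc_scale b i) = inc_scale (a * b) i.
Proof. by apply: incidence_ext => x y /=; rewrite mulrA. Qed.
Fact inc_scale1 : left_id 1 inc_scale.
Proof. by move=> i; apply: incidence_ext => x y /=; rewrite mul1r. Qed.
Fact inc_scaleDr : right_distributive inc_scale +%R.
Proof. by move=> a i j; apply: incidence_ext => x y /=; rewrite -mulrDr. Qed.
Fact inc_scaleDl i : {morph inc_scale^~ i : a b / a + b}.
Proof. by move=> a b; apply: incidence_ext => x y /=; rewrite mulrDl. Qed.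
HB.instance Definition _ := GRing.Zmodule_isLmodule.Build K incidence
  inc_scaleA inc_scale1 inc_scaleDr inc_scaleDl.

Lemma incidence0E x y : (0 : incidence) x y = 0. Proof. by []. Qed.
Lemma incidenceDE i j x y : (i + j) x y = i x y + j x y. Proof. by []. Qed.
Lemma incidenceNE i x y : (- i) x y = - i x y. Proof. by []. Qed.
Lemma incidenceZE a i x y : (a *: i) x y = a * i x y. Proof. by []. Qed.

(* The sum has finite support, and is the usual convolution, as soon as one of
   the factors is finitary; by convention [\sum_(z \in A)] is 0 on summands of
   infinite support, so [inc_mul i j] is only meaningful when [i] or [j]
   belongs to the finitary incidence algebra. *)
Definition conv f g x y : K :=
  \sum_(z \in [set z | (x <= z <= y)%O]) f x z * g z y.

Fact conv_incidence f g : conv f g \in incidence_pred.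
Proof.
apply/asboolP => x y xy; apply: fsbig1 => z /andP[xz zy].
by rewrite (le_trans xz zy) in xy.
Qed.

Definition inc_mul i j : incidence := Incidence (conv_incidence i j).

Lemma inc_mulE i j x y : inc_mul i j x y = conv i j x y. Proof. by []. Qed.

Lemma convE i j x y (s : seq X) : uniq s ->
  (forall z, i x z * j z y != 0 -> z \in s) ->
  conv i j x y = \sum_(z <- s) i x z * j z y.
Proof.
move=> us Hs; rewrite fsbig_seq // /conv [LHS]fsbig_supp [RHS]fsbig_supp.
apply: eq_fsbigl; apply/seteqP; split=> z /= [A B]; split; try exact: B.
  by apply: Hs; apply/eqP.
by move/eqP: B; rewrite mulf_eq0 negb_or => /andP[/incidence_le -> /incidence_le].
Qed.

Lemma conv_neq0 i j x y : conv i j x y != 0 ->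
  exists z, i x z * j z y != 0.
Proof.
by move=> /(@fsbigN1 _ _ _ X _ _ (fun x z => i x z * j z y) x)[z _]; exists z.
Qed.

Lemma conv_diagl i j x y : (forall u v, u != v -> i u v = 0) ->
  conv i j x y = i x x * j x y.
Proof.
move=> Hi; rewrite (@convE _ _ _ _ [:: x]) ?big_seq1 // => z.
by rewrite inE; apply: contraNT => zx; rewrite Hi ?mul0r // eq_sym.
Qed.

Lemma conv_diagr i j x y : (forall u v, u != v -> j u v = 0) ->
  conv i j x y = i x y * j y y.
Proof.
move=> Hj; rewrite (@convE _ _ _ _ [:: y]) ?big_seq1 // => z.
by rewrite inE; apply: contraNT => zy; rewrite Hj ?mulr0.
Qed.

Lemma conv_finite_seq (A : set X) : finite_set A ->
  exists2 s : seq X, uniq s & forall z, A z -> z \in s.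
Proof.
move=> /finite_seqP[s ->]; exists (undup s); first exact: undup_uniq.
by move=> z; rewrite mem_undup.
Qed.

Definition conv_fin i j := forall x y,
  finite_set [set z | i x z * j z y != 0].

Lemma inc_mulDl i j k : conv_fin i k -> conv_fin j k ->
  inc_mul (i + j) k = inc_mul i k + inc_mul j k.
Proof.
move=> ik jk; apply: incidence_ext => x y.
have [s us Hs] : exists2 s : seq X, uniq s & forall z,
    ([set z | i x z * k z y != 0] `|` [set z | j x z * k z y != 0]) z -> z \in s.
  by apply: conv_finite_seq; rewrite finite_setU; split.
rewrite incidenceDE !inc_mulE !(@convE _ _ _ _ s) //.
- by rewrite -big_split; apply: eq_bigr => z _; rewrite incidenceDE mulrDl.
- by move=> z ?; apply: Hs; right.
- by move=> z ?; apply: Hs; left.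
move=> z H; apply: Hs => /=; have [h|] := eqVneq (i x z * k z y) 0; last by left.
by right; move: H; rewrite incidenceDE mulrDl h add0r.
Qed.

Lemma inc_mulDr i j k : conv_fin i j -> conv_fin i k ->
  inc_mul i (j + k) = inc_mul i j + inc_mul i k.
Proof.
move=> ij ik; apply: incidence_ext => x y.
have [s us Hs] : exists2 s : seq X, uniq s & forall z,
    ([set z | i x z * j z y != 0] `|` [set z | i x z * k z y != 0]) z -> z \in s.
  by apply: conv_finite_seq; rewrite finite_setU; split.
rewrite incidenceDE !inc_mulE !(@convE _ _ _ _ s) //.
- by rewrite -big_split; apply: eq_bigr => z _; rewrite incidenceDE mulrDr.
- by move=> z ?; apply: Hs; right.
- by move=> z ?; apply: Hs; left.
move=> z H; apply: Hs => /=; have [h|] := eqVneq (i x z * j z y) 0; last by left.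
by right; move: H; rewrite incidenceDE mulrDr h add0r.
Qed.

Lemma inc_mulZl a i j : conv_fin i j ->
  inc_mul (a *: i) j = a *: inc_mul i j.
Proof.
move=> ij; apply: incidence_ext => x y; rewrite incidenceZE !inc_mulE.
have [s us Hs] := conv_finite_seq (ij x y).
rewrite !(@convE _ _ _ _ s) //.
  by rewrite mulr_sumr; apply: eq_bigr => z _; rewrite incidenceZE mulrA.
move=> z; rewrite incidenceZE -mulrA => H; apply: Hs.
by apply: contraNneq H => /= ->; rewrite mulr0.
Qed.

Lemma inc_mulZr a i j : conv_fin i j ->
  inc_mul i (a *: j) = a *: inc_mul i j.
Proof.
move=> ij; apply: incidence_ext => x y; rewrite incidenceZE !inc_mulE.
have [s us Hs] := conv_finite_seq (ij x y).
rewrite !(@convE _ _ _ _ s) //.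
  by rewrite mulr_sumr; apply: eq_bigr => z _; rewrite incidenceZE mulrCA.
move=> z; rewrite incidenceZE mulrCA => H; apply: Hs.
by apply: contraNneq H => /= ->; rewrite mulr0.
Qed.

Lemma inc_mulA i j k :
    (forall x y, finite_set
       [set p : X * X | i x p.1 * j p.1 p.2 * k p.2 y != 0]) ->
  inc_mul i (inc_mul j k) = inc_mul (inc_mul i j) k.
Proof.
move=> ijk; apply: incidence_ext => x y.
have /conv_finite_seq[s us Hs] : finite_set
    (fst @` [set p : X * X | i x p.1 * j p.1 p.2 * k p.2 y != 0] `|`
     snd @` [set p : X * X | i x p.1 * j p.1 p.2 * k p.2 y != 0]).
  by rewrite finite_setU; split; apply: finite_image.
have {}Hs z w : i x z * j z w * k w y != 0 -> z \in s /\ w \in s.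
  by move=> H; split; apply: Hs; [left|right]; exists (z, w).
have E1 z : i x z * conv j k z y = \sum_(w <- s) i x z * j z w * k w y.
  have [->|i0] := eqVneq (i x z) 0.
    by rewrite mul0r big1 // => w _; rewrite !mul0r.
  rewrite (@convE _ _ _ _ s) //.
    by rewrite mulr_sumr; apply: eq_bigr => w _; rewrite mulrA.
  by move=> w H; apply: (proj2 (Hs z w _)); rewrite -mulrA mulf_neq0.
have E2 w : conv i j x w * k w y = \sum_(z <- s) i x z * j z w * k w y.
  have [->|k0] := eqVneq (k w y) 0.
    by rewrite mulr0 big1 // => z _; rewrite !mulr0.
  rewrite (@convE _ _ _ _ s) ?mulr_suml //.
  by move=> z H; apply: (proj1 (Hs z w _)); rewrite mulf_neq0.
rewrite !inc_mulE !(@convE _ _ _ _ s) //.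
- rewrite (eq_bigr _ (fun z _ => E1 z)) exchange_big.
  by apply: eq_bigr => w _; rewrite E2.
- move=> w; rewrite mulf_eq0 negb_or => /andP[/conv_neq0[z H] k0].
  by apply: (proj2 (Hs z w _)); rewrite mulf_neq0.
move=> z; rewrite mulf_eq0 negb_or => /andP[i0 /conv_neq0[w H]].
by apply: (proj1 (Hs z w _)); rewrite -mulrA mulf_neq0.
Qed.

(* A subinterval [u, v] of [x, y] is recorded by its pair (u, v) of end
   points. *)
Definition finitary_pred : {pred incidence} :=
  [pred f : incidence | `[< forall x y, (x <= y)%O ->
    finite_set [set p : X * X | [/\ (x <= p.1)%O, (p.1 <= p.2)%O,
      (p.2 <= y)%O, p.1 != p.2 & f p.1 p.2 != 0]] >]].

Fact finitary_pred_submod : submod_closed finitary_pred.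
Proof.
split=> [|a f g /asboolP ff /asboolP fg]; apply/asboolP => x y xy.
  by apply: (@sub_finite_set _ _ set0) => // p [_ _ _ _ /eqP].
have H := finite_setUW (ff x y xy) (fg x y xy).
apply: sub_finite_set H => p /= [? ? ? ? fgp].
have [f0|f0] := eqVneq (f p.1 p.2) 0; last by left; split.
right; split => //; apply: contraNneq fgp => g0.
by apply/eqP; rewrite -[LHS]/(a * f p.1 p.2 + g p.1 p.2) f0 g0 mulr0 addr0.
Qed.
HB.instance Definition _ :=
  GRing.isSubmodClosed.Build K incidence finitary_pred finitary_pred_submod.

Record finc := FInc {
  finc_val :> incidence;
  _ : finc_val \in finitary_pred }.

HB.instance Definition _ := [isSub for finc_val].
HB.instance Definition _ := [Choice of finc by <:].
HB.instance Definition _ := [SubChoice_isSubLmodule of finc by <:].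

Lemma fincP (f : finc) x y : (x <= y)%O ->
  finite_set [set p : X * X | [/\ (x <= p.1)%O, (p.1 <= p.2)%O,
    (p.2 <= y)%O, p.1 != p.2 & f p.1 p.2 != 0]].
Proof. by case: f => f /= /asboolP; apply. Qed.

Lemma finc_ext (f g : finc) : (forall x y, f x y = g x y) -> f = g.
Proof. by move=> fg; apply: val_inj; apply: incidence_ext. Qed.

Lemma finc_supp_row (f : finc) x y :
  finite_set [set z | (z <= y)%O && (f x z != 0)].
Proof.
have [xy|xy] := boolP (x <= y)%O; last first.
  apply: (@sub_finite_set _ _ set0) => // z /= /andP[zy /incidence_le xz].
  by rewrite (le_trans xz zy) in xy.
have H := finite_setUW (finite_set1 x) (finite_image snd (fincP f xy)).
apply: sub_finite_set H => z /= /andP[zy f0].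
have [->|zx] := eqVneq z x; [by left | right].
by exists (x, z) => //=; split; rewrite // ?(incidence_le f0) // eq_sym.
Qed.

Lemma finc_supp_col (f : finc) x y :
  finite_set [set z | (x <= z)%O && (f z y != 0)].
Proof.
have [xy|xy] := boolP (x <= y)%O; last first.
  apply: (@sub_finite_set _ _ set0) => // z /= /andP[xz /incidence_le zy].
  by rewrite (le_trans xz zy) in xy.
have H := finite_setUW (finite_set1 y) (finite_image fst (fincP f xy)).
apply: sub_finite_set H => z /= /andP[xz f0].
have [->|zy] := eqVneq z y; [by left | right].
by exists (z, y) => //=; split; rewrite // ?(incidence_le f0).
Qed.

Lemma conv_finl (f : finc) i : conv_fin f i.
Proof.
move=> x y; apply: sub_finite_set (finc_supp_row f x y) => z /=.
by rewrite mulf_eq0 negb_or => /andP[-> /incidence_le ->].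
Qed.

Lemma conv_finr i (f : finc) : conv_fin i f.
Proof.
move=> x y; apply: sub_finite_set (finc_supp_col f x y) => z /=.
by rewrite mulf_eq0 negb_or => /andP[/incidence_le -> ->].
Qed.

Fact finc_mul_subproof (f g : finc) : inc_mul f g \in finitary_pred.
Proof.
apply/asboolP => x y xy.
have F := fincP f xy; have G := fincP g xy.
set A := [set p | _] in F; set B := [set p | _] in G.
have H := finite_setUW (finite_setUW F G)
  (finite_image (fun q : (X * X) * (X * X) => (q.1.1, q.2.2)) (finite_setX F G)).
apply: sub_finite_set H => -[u v] /= [xu uv vy neuv /conv_neq0[z]].
rewrite mulf_eq0 negb_or => /andP[f0 g0].
have uz := incidence_le f0; have zv := incidence_le g0.
have zy := le_trans zv vy; have xz := le_trans xu uz.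
have [zu|zu] := eqVneq z u; first by left; right; split; rewrite //= -zu.
have [ev|nev] := eqVneq z v; first by left; left; split; rewrite //= -ev.
by right; exists ((u, z), (z, v)) => //; do 2!split => //=; rewrite eq_sym.
Qed.
Definition finc_mul (f g : finc) : finc := FInc (finc_mul_subproof f g).

Fact inc_delta_subproof : (fun x y => (x == y)%:R) \in incidence_pred.
Proof. by apply/asboolP => x y; have [->|] := eqVneq x y; rewrite ?lexx. Qed.
Fact finc_delta_subproof : Incidence inc_delta_subproof \in finitary_pred.
Proof.
apply/asboolP => x y _; apply: (@sub_finite_set _ _ set0) => // p.
by case=> _ _ _ /negPf /= ->; rewrite eqxx.
Qed.
Definition finc_delta : finc := FInc finc_delta_subproof.

Lemma inc_mulfgi (f g : finc) i :
  inc_mul f (inc_mul g i) = inc_mul (finc_mul f g) i.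
Proof.
apply: inc_mulA => x y.
apply: sub_finite_set (finite_setXR (A := [set z | (z <= y)%O && (f x z != 0)])
  (B := fun z => [set w | (w <= y)%O && (g z w != 0)]) _ _) => /=.
- case=> z w /=; rewrite !mulf_eq0 !negb_or => /andP[/andP[f0 g0] i0].
  have wy := incidence_le i0; have zw := incidence_le g0.
  by rewrite (le_trans zw wy) wy.
- exact: finc_supp_row.
- by move=> z _; exact: finc_supp_row.
Qed.

Lemma inc_mulfig (f g : finc) i :
  inc_mul f (inc_mul i g) = inc_mul (inc_mul f i) g.
Proof.
apply: inc_mulA => x y.
apply: sub_finite_set (finite_setX (finc_supp_row f x y)
  (finc_supp_col g x y)) => -[z w] /=.
rewrite !mulf_eq0 !negb_or => /andP[/andP[f0 i0] g0].
have zw := incidence_le i0.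
by rewrite f0 g0 (le_trans zw (incidence_le g0)) (le_trans (incidence_le f0) zw).
Qed.

Lemma inc_mulifg (f g : finc) i :
  inc_mul i (finc_mul f g) = inc_mul (inc_mul i f) g.
Proof.
apply: (@inc_mulA i f g) => x y.
apply: sub_finite_set (finite_setXL (A := fun w => [set z | (x <= z)%O && (f z w != 0)])
  (B := [set w | (x <= w)%O && (g w y != 0)]) _ _) => /=.
- case=> z w /=; rewrite !mulf_eq0 !negb_or => /andP[/andP[i0 f0] g0].
  have xz := incidence_le i0; have zw := incidence_le f0.
  by rewrite (le_trans xz zw) xz.
- by move=> z _; exact: finc_supp_col.
- exact: finc_supp_col.
Qed.

Lemma inc_mul1l i : inc_mul finc_delta i = i.
Proof.
apply: incidence_ext => x y; rewrite inc_mulE conv_diagl.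
  by rewrite /= eqxx mul1r.
by move=> u v /= /negPf ->.
Qed.

Lemma inc_mul1r i : inc_mul i finc_delta = i.
Proof.
apply: incidence_ext => x y; rewrite inc_mulE conv_diagr.
  by rewrite /= eqxx mulr1.
by move=> u v /= /negPf ->.
Qed.

Fact finc_mulDl : left_distributive finc_mul +%R.
Proof. by move=> f g h; apply: val_inj; apply: inc_mulDl; apply: conv_finl. Qed.
Fact finc_mulDr : right_distributive finc_mul +%R.
Proof. by move=> f g h; apply: val_inj; apply: inc_mulDr; apply: conv_finl. Qed.
Fact finc_mulA : associative finc_mul.
Proof. by move=> f g h; apply: val_inj; apply: inc_mulfgi. Qed.
Fact finc_mul1l : left_id finc_delta finc_mul.
Proof. by move=> f; apply: val_inj; apply: inc_mul1l. Qed.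
Fact finc_mul1r : right_id finc_delta finc_mul.
Proof. by move=> f; apply: val_inj; apply: inc_mul1r. Qed.
HB.instance Definition _ := GRing.Zmodule_isPzRing.Build finc
  finc_mulA finc_mul1l finc_mul1r finc_mulDl finc_mulDr.

(* [lalgType] and [algType] exclude the zero ring, hence the empty poset; the
   algebra axioms relating scaling and product are these lemmas. *)
Lemma finc_scalerAl (a : K) (f g : finc) : a *: (f * g) = (a *: f) * g.
Proof. by apply: val_inj; apply/esym/inc_mulZl/conv_finl. Qed.
Lemma finc_scalerAr (a : K) (f g : finc) : a *: (f * g) = f * (a *: g).
Proof. by apply: val_inj; apply/esym/inc_mulZr/conv_finl. Qed.

End IncidenceSpace.

Notation "i '**' j" := (inc_mul i j) (at level 40, left associativity).

Section Idealization.
Context {d : Order.disp_t} (X : porderType d) (K : fieldType).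

Definition idealization : Type := (finc X K * incidence X K)%type.

HB.instance Definition _ :=
  GRing.Lmodule.copy idealization (finc X K * incidence X K)%type.

Definition ideal_one : idealization := (1, 0).
Definition ideal_mul (a b : idealization) : idealization :=
  (a.1 * b.1, a.1 ** b.2 + a.2 ** b.1).

Fact ideal_ext (a b : idealization) : a.1 = b.1 -> a.2 = b.2 -> a = b.
Proof. by case: a b => [? ?] [? ?] /= -> ->. Qed.

Fact ideal_mulDl : left_distributive ideal_mul +%R.
Proof.
move=> a b c; apply: ideal_ext; first exact: mulrDl.
rewrite -[LHS]/((finc_val a.1 + finc_val b.1) ** c.2 + (a.2 + b.2) ** c.1).
rewrite (inc_mulDl (conv_finl _ _) (conv_finl _ _)).
by rewrite (inc_mulDl (conv_finr _ _) (conv_finr _ _)) addrACA.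
Qed.
Fact ideal_mulDr : right_distributive ideal_mul +%R.
Proof.
move=> a b c; apply: ideal_ext; first exact: mulrDr.
rewrite -[LHS]/(a.1 ** (b.2 + c.2) + a.2 ** (finc_val b.1 + finc_val c.1)).
rewrite (inc_mulDr (conv_finl _ _) (conv_finl _ _)).
by rewrite (inc_mulDr (conv_finr _ _) (conv_finr _ _)) addrACA.
Qed.
Fact ideal_mulA : associative ideal_mul.
Proof.
move=> a b c; apply: ideal_ext; first exact: mulrA.
rewrite -[LHS]/(a.1 ** (b.1 ** c.2 + b.2 ** c.1) + a.2 ** (finc_mul b.1 c.1)).
rewrite -[RHS]/(finc_mul a.1 b.1 ** c.2 + (a.1 ** b.2 + a.2 ** b.1) ** c.1).
rewrite (inc_mulDr (conv_finl _ _) (conv_finl _ _)).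
rewrite (inc_mulDl (conv_finr _ _) (conv_finr _ _)).
by rewrite inc_mulfgi inc_mulfig inc_mulifg addrA.
Qed.
Fact ideal_mul1l : left_id ideal_one ideal_mul.
Proof.
move=> a; apply: ideal_ext; first exact: mul1r.
rewrite -[LHS]/(finc_delta X K ** a.2 + 0 ** a.1) inc_mul1l.
rewrite -(scale0r (0 : incidence X K)) (inc_mulZl _ (conv_finr _ _)).
by rewrite scale0r addr0.
Qed.
Fact ideal_mul1r : right_id ideal_one ideal_mul.
Proof.
move=> a; apply: ideal_ext; first exact: mulr1.
rewrite -[LHS]/(a.1 ** 0 + a.2 ** finc_delta X K) inc_mul1r.
rewrite -(scale0r (0 : incidence X K)) (inc_mulZr _ (conv_finl _ _)).
by rewrite scale0r add0r.
Qed.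
HB.instance Definition _ := GRing.Zmodule_isPzRing.Build idealization
  ideal_mulA ideal_mul1l ideal_mul1r ideal_mulDl ideal_mulDr.

Lemma ideal_scalerAl (c : K) (a b : idealization) : c *: (a * b) = (c *: a) * b.
Proof.
apply: ideal_ext; first exact: finc_scalerAl.
rewrite -[LHS]/(c *: (a.1 ** b.2 + a.2 ** b.1)).
rewrite -[RHS]/((c *: finc_val a.1) ** b.2 + (c *: a.2) ** b.1) scalerDr.
by rewrite (inc_mulZl _ (conv_finl _ _)) (inc_mulZl _ (conv_finr _ _)).
Qed.
Lemma ideal_scalerAr (c : K) (a b : idealization) : c *: (a * b) = a * (c *: b).
Proof.
apply: ideal_ext; first exact: finc_scalerAr.
rewrite -[LHS]/(c *: (a.1 ** b.2 + a.2 ** b.1)).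
rewrite -[RHS]/(a.1 ** (c *: b.2) + a.2 ** (c *: finc_val b.1)) scalerDr.
by rewrite (inc_mulZr _ (conv_finl _ _)) (inc_mulZr _ (conv_finr _ _)).
Qed.

End Idealization.

Section Posets.
Context {d : Order.disp_t} (X : porderType d).

Definition connected_poset : Prop := forall x y : X,
  exists2 s : seq X, path (fun u v => u >=< v)%O x s & last x s = y.

Record poset_involution := PosetInvolution {
  poset_inv_fun :> X -> X;
  poset_inv_anti : forall x y,
    (x <= y)%O = (poset_inv_fun y <= poset_inv_fun x)%O;
  poset_inv_invol : involutive poset_inv_fun }.

Definition adapted_partition (lam : poset_involution) (X1 X2 : set X) : Prop :=
  [/\ X1 `|` X2 = [set: X] /\ X1 `&` X2 = set0,
      lam @` X1 = X2 /\ lam @` X2 = X1,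
      forall x y, X1 x -> (y <= x)%O -> X1 y
    & forall x y, X2 x -> (x <= y)%O -> X2 y].

End Posets.

(* [unitRingType] also excludes the zero ring: a unit is given together with its
   two-sided inverse. *)
Definition mutual_inverse (A : pzRingType) (u v : A) : Prop :=
  u * v = 1 /\ v * u = 1.

Definition inner_automorphism (A : pzRingType) (phi : A -> A) : Prop :=
  exists u v, mutual_inverse u v /\ forall a, phi a = u * a * v.

Definition conjugate (A : pzRingType) (a b : A) : Prop :=
  exists u v, mutual_inverse u v /\ b = u * a * v.

Section Maps.
Context {d : Order.disp_t} (X : porderType d) (K : fieldType).
Implicit Types (lam : poset_involution X) (x y : X).

Definition multiplicative_weight (s : incidence X K) : Prop :=
  (forall x y, (x <= y)%O -> s x y != 0) /\
  (forall x y z, (x <= y)%O -> (y <= z)%O -> s x y * s y z = s x z).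

Fact inc_hadamard_subproof (s i : incidence X K) :
  (fun x y => s x y * i x y) \in @incidence_pred _ X K.
Proof. by apply/asboolP => x y /incidenceP ->; rewrite mul0r. Qed.

Fact mult_aut_subproof (s : incidence X K) (f : finc X K) :
  Incidence (inc_hadamard_subproof s f) \in @finitary_pred _ X K.
Proof.
apply/asboolP => x y xy; apply: sub_finite_set (fincP f xy) => p /= [? ? ? ? H].
by split=> //; apply: contraNneq H => ->; rewrite mulr0.
Qed.

(* The map M_s; it is an automorphism when [multiplicative_weight s]. *)
Definition mult_aut (s : incidence X K) (f : finc X K) : finc X K :=
  FInc (mult_aut_subproof s f).

Definition derivation (D : finc X K -> incidence X K) : Prop :=
  linear D /\ forall f g : finc X K, D (f * g) = D f ** g + f ** D g.

Definition inner_derivation (D : finc X K -> incidence X K) : Prop :=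
  exists i : incidence X K, forall f : finc X K, D f = f ** i - i ** f.

Fact inc_diag_subproof (c : X -> K) :
  (fun x y => if x == y then c x else 0) \in @incidence_pred _ X K.
Proof. by apply/asboolP => x y; case: eqVneq => // ->; rewrite lexx. Qed.

Fact finc_diag_subproof (c : X -> K) :
  Incidence (inc_diag_subproof c) \in @finitary_pred _ X K.
Proof.
apply/asboolP => x y _; apply: (@sub_finite_set _ _ set0) => // p.
by case=> _ _ _ /negPf /= ->; rewrite eqxx.
Qed.

Definition finc_diag (c : X -> K) : finc X K := FInc (finc_diag_subproof c).

Lemma finc_diagM (c e : X -> K) :
  finc_diag c * finc_diag e = finc_diag (fun x => c x * e x).
Proof.
apply: finc_ext => x y.
rewrite -[LHS]/(conv (finc_diag c) (finc_diag e) x y) conv_diagl.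
  by rewrite /= eqxx; case: eqP => //; rewrite mulr0.
by move=> u v /= /negPf ->.
Qed.

Definition finc_e x : finc X K := finc_diag (fun y => (y == x)%:R).

(* w is its own inverse ([finc_wM]), so w^-1 is written w below. *)
Definition finc_w (X1 : set X) : finc X K :=
  finc_diag (fun x => if x \in X1 then 1 else -1).

Lemma finc_wM (X1 : set X) : finc_w X1 * finc_w X1 = 1.
Proof.
rewrite finc_diagM; apply: finc_ext => x y /=.
by case: eqVneq => // _; case: ifP => _; rewrite ?mulrNN mulr1.
Qed.

Fact inc_rho_subproof lam (i : incidence X K) :
  (fun x y => i (lam y) (lam x)) \in @incidence_pred _ X K.
Proof. by apply/asboolP => x y xy; apply: incidenceP; rewrite -poset_inv_anti. Qed.

Definition inc_rho lam (i : incidence X K) : incidence X K :=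
  Incidence (inc_rho_subproof lam i).

Fact finc_rho_subproof lam (f : finc X K) : inc_rho lam f \in @finitary_pred _ X K.
Proof.
apply/asboolP => x y; rewrite (poset_inv_anti lam) => /(fincP f) H.
have := finite_image (fun p : X * X => (lam p.2, lam p.1)) H.
apply: sub_finite_set => -[u v] /= [xu uv vy neuv f0].
exists (lam v, lam u) => /=; last by rewrite !(poset_inv_invol lam).
split; rewrite -?(poset_inv_anti lam) //.
by rewrite (inj_eq (inv_inj (poset_inv_invol lam))) eq_sym.
Qed.

Definition finc_rho lam (f : finc X K) : finc X K :=
  FInc (finc_rho_subproof lam f).

Definition rho_tilde lam (a : idealization X K) : idealization X K :=
  (finc_rho lam a.1, inc_rho lam a.2).

Definition sigma_tilde lam (X1 : set X) (a : idealization X K) :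
    idealization X K :=
  (finc_w X1 * finc_rho lam a.1 * finc_w X1,
   finc_w X1 ** inc_rho lam a.2 ** finc_w X1).

(* The map written $\widetilde{-\delta}$. *)
Definition neg_tilde (a : idealization X K) : idealization X K := (a.1, - a.2).

Definition automorphism (Psi : idealization X K -> idealization X K) : Prop :=
  [/\ linear Psi, monoid_morphism Psi & bijective Psi].

Definition algebra_involution (Phi : idealization X K -> idealization X K) :
    Prop :=
  [/\ linear Phi, {morph Phi : a b / a * b >-> b * a} & involutive Phi].

Definition equivalent (Phi Phi' : idealization X K -> idealization X K) : Prop :=
  exists2 Psi, automorphism Psi & Psi \o Phi =1 Phi' \o Psi.

Definition induces (Phi : idealization X K -> idealization X K)
    (lam : X -> X) : Prop :=
  forall x, conjugate (Phi (finc_e x, 0)) (finc_e (lam x), 0).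

End Maps.

(* Main.v *)
Require Import Defs.
From HB Require Import structures.
From mathcomp Require Import all_boot all_order all_algebra.
From mathcomp Require Import boolp classical_sets cardinality functions fsbigop.

(** The argument goes through the automorphisms of the finitary incidence
    algebra FI and of the idealization D.

    Automorphisms of FI. An automorphism t maps each idempotent e_x to an
    idempotent p with p FI p = K p; such a p is nonzero at exactly one diagonal
    place al(x), and al is an automorphism of the poset ([aut_poset]). If al is
    the identity, the columns of the t(e_y) at y form a function [conjugator];
    the main point is that it is finitary. It is then a unit conjugating every
    e_x to t(e_x), which leaves a multiplicative automorphism; so t is inner
    ([finc_aut_inner]).

    Automorphisms of D. The centre of D is K + K eps with eps = (0, delta), so an
    automorphism multiplies eps by a nonzero scalar, preserves the second
    summand, and induces an automorphism of FI. If the latter fixes the e_x up to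
    conjugacy, the innerness of the derivations shows that the automorphism is,
    up to an inner one, the multiplication of the second component by that
    scalar ([ideal_aut_inner]).

    Inequivalence. The involutions composed with [neg_tilde] negate eps, the
    others fix it, and an automorphism scales eps ([not_equivalent_neg]). An
    equivalence between an involution of type rho and one of type sigma would
    give one on FI, necessarily inner by some u up to an automorphism of the
    poset commuting with lambda. Then rho(u) w u is central, hence a scalar,
    whereas its entries at x and lambda(x) are opposite and nonzero
    ([finc_rho_sigma_not_equivalent]).

    Classification. An involution inducing lambda has the form U R(a) U^-1 where
    R is the reflection along lambda, possibly composed with [neg_tilde]
    ([induces_inner_twist]). As its square is the identity, U and R(U) differ by
    a central factor, and U can be changed by a central unit so that R(U) = U or
    R(U) = -U. In the second case U w is symmetric for the involution
    w R(a) w ([inner_twist_equivalent]). Finally, D is block triangular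
    for the partition of the poset, R exchanges the two diagonal blocks, and so
    a symmetric unit has the form V R(V) ([triangular_square]); conjugation by V
    is the required equivalence. *)

Set Implicit Arguments.
Unset Strict Implicit.
Unset Printing Implicit Defensive.

Import Order.TTheory GRing.Theory.

Local Open Scope classical_set_scope.
Local Open Scope ring_scope.

(** * Conjugation in rings and linear maps *)

Section Conjugation.
Variable A : pzRingType.
Implicit Types s t u v : A.

Lemma conjM s t a b : t * s = 1 -> s * (a * b) * t = s * a * t * (s * b * t).
Proof. by move=> ts; rewrite !mulrA -(mulrA _ t s) ts mulr1. Qed.

Lemma conjK s t a : s * t = 1 -> s * (t * a * s) * t = a.
Proof. by move=> st; rewrite !mulrA st mul1r -mulrA st mulr1. Qed.

Lemma invM u v u' v' : u * v = 1 -> u' * v' = 1 -> u * u' * (v' * v) = 1.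
Proof. by move=> uv uv'; rewrite mulrA -(mulrA u) uv' mulr1. Qed.

Lemma mutual_inverse_mul u v u' v' :
  mutual_inverse u v -> mutual_inverse u' v' -> mutual_inverse (u * u') (v' * v).
Proof. by case=> uv vu [uv' vu']; split; apply: invM. Qed.

End Conjugation.

Section LinearMaps.
Variables (K : fieldType) (U V : lmodType K) (f : U -> V).
Hypothesis f_lin : linear f.

Lemma linear_add u v : f (u + v) = f u + f v.
Proof. by have := f_lin 1 u v; rewrite !scale1r. Qed.

Lemma linear_zero : f 0 = 0.
Proof. by apply: (addrI (f 0)); rewrite -linear_add !addr0. Qed.

Lemma linear_scale a u : f (a *: u) = a *: f u.
Proof. by have := f_lin a u 0; rewrite linear_zero !addr0. Qed.

End LinearMaps.

(** * Entries of products with diagonal idempotents *)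

Section Entries.
Context {d : Order.disp_t} {X : porderType d} {K : fieldType}.
Implicit Types (i j : incidence X K) (f g p : finc X K) (x y z : X).

Lemma finc_val_mul f g : finc_val (f * g) = f ** g. Proof. by []. Qed.

Lemma finc1E x y : (1 : finc X K) x y = (x == y)%:R. Proof. by []. Qed.

Lemma finc_mulE f g x y : (f * g) x y = (f ** g) x y. Proof. by []. Qed.

Lemma finc_eE x a b : finc_e K x a b = ((a == x) && (b == x))%:R.
Proof.
rewrite /=; have [->|] := eqVneq a b; first by rewrite andbb.
by have [->|//] := eqVneq a x; rewrite eq_sym => /negPf ->.
Qed.

Lemma inc_mul_diagr i (c : X -> K) a b : (i ** finc_diag c) a b = i a b * c b.
Proof. by rewrite inc_mulE conv_diagr /= ?eqxx // => u v /= /negPf ->. Qed.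

Lemma inc_mul_diagl i (c : X -> K) a b : (finc_diag c ** i) a b = c a * i a b.
Proof. by rewrite inc_mulE conv_diagl /= ?eqxx // => u v /= /negPf ->. Qed.

Lemma inc_mul_er i y a b : (i ** finc_e K y) a b = i a b * (b == y)%:R.
Proof. exact: inc_mul_diagr. Qed.

Lemma inc_mul_el i x a b : (finc_e K x ** i) a b = (a == x)%:R * i a b.
Proof. exact: inc_mul_diagl. Qed.

Lemma inc_mul_neq0 i j x y : (i ** j) x y != 0 ->
  exists z, [/\ i x z != 0, j z y != 0, (x <= z)%O & (z <= y)%O].
Proof.
move=> /conv_neq0[z]; rewrite mulf_eq0 negb_or => /andP[i0 j0].
by exists z; split=> //; [exact: (incidence_le i0) | exact: (incidence_le j0)].
Qed.

Lemma inc_mul_diag i j x : (i ** j) x x = i x x * j x x.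
Proof.
rewrite inc_mulE (@convE _ _ _ _ _ _ _ [:: x]) ?big_seq1 // => z.
rewrite mulf_eq0 negb_or inE => /andP[/incidence_le xz /incidence_le zx].
by rewrite eq_le xz zx.
Qed.

Lemma mul_e_mulE f g x a b : (f * finc_e K x * g) a b = f a x * g x b.
Proof.
rewrite finc_mulE inc_mulE (@convE _ _ _ _ _ _ _ [:: x]) ?big_seq1 // => [|z].
  by rewrite finc_val_mul inc_mul_er eqxx mulr1.
rewrite finc_val_mul inc_mul_er inE; case: (z == x) => //.
by rewrite mulr0 mul0r eqxx.
Qed.

Lemma finc_ee x : finc_e K x * finc_e K x = finc_e K x.
Proof.
apply: finc_ext => a b; rewrite finc_mulE inc_mul_er finc_eE.
by case: (a == x); case: (b == x); rewrite /= ?mulr1 ?mulr0.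
Qed.

Lemma finc_ee0 x y : x != y -> finc_e K x * finc_e K y = 0.
Proof.
move=> xy; apply: finc_ext => a b; rewrite finc_mulE inc_mul_er finc_eE.
have [->|_] := eqVneq b x; first by rewrite (negPf xy) mulr0.
by rewrite andbF mul0r.
Qed.

Fact finc_unit_subproof x y :
  (fun a b => ((x <= y)%O && ((a == x) && (b == y)))%:R) \in @incidence_pred _ X K.
Proof.
by apply/asboolP => a b; case: eqVneq => [->|]; case: eqVneq => [->|];
  case: (x <= y)%O.
Qed.

Fact finc_unit_subproof2 x y :
  Incidence (finc_unit_subproof x y) \in @finitary_pred _ X K.
Proof.
apply/asboolP => a b _; apply: (@sub_finite_set _ _ [set (x, y)]) => //.
case=> u v [_ _ _ _] /=; have [->|_] := eqVneq u x; last first.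
  by rewrite andbF eqxx.
by have [->|_] := eqVneq v y; rewrite // !andbF eqxx.
Qed.

(** The matrix unit at the pair (x, y); it is 0 unless [x <= y]. *)
Definition finc_unit x y : finc X K := FInc (finc_unit_subproof2 x y).

Lemma finc_unitE x y a b : (x <= y)%O ->
  finc_unit x y a b = ((a == x) && (b == y))%:R.
Proof. by rewrite /= => ->. Qed.

Lemma finc_unit_neq0 x y : (x <= y)%O -> finc_unit x y != 0.
Proof.
move=> xy; apply/eqP => /(congr1 (fun f : finc X K => f x y)).
by rewrite finc_unitE // !eqxx => /eqP; rewrite oner_eq0.
Qed.

Lemma finc_unit_diag x : finc_unit x x = finc_e K x.
Proof. by apply: finc_ext => a b; rewrite finc_unitE // finc_eE. Qed.

Lemma e_mul_unit x y : finc_e K x * finc_unit x y = finc_unit x y.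
Proof.
apply: finc_ext => a b; rewrite finc_mulE inc_mul_el /=.
by case: (a == x); rewrite /= ?mul1r ?mul0r // andbF.
Qed.

Lemma unit_mul_e x y : finc_unit x y * finc_e K y = finc_unit x y.
Proof.
apply: finc_ext => a b; rewrite finc_mulE inc_mul_er /=.
by case: (b == y); rewrite /= ?mulr1 ?mulr0 // !andbF.
Qed.

Lemma finc_unitM x y z : (x <= y)%O -> (y <= z)%O ->
  finc_unit x y * finc_unit y z = finc_unit x z.
Proof.
move=> xy yz; apply: finc_ext => a b; rewrite finc_mulE inc_mulE.
rewrite (@convE _ _ _ _ _ _ _ [:: y]) ?big_seq1 // => [|w].
  rewrite !finc_unitE ?(le_trans xy yz) // !eqxx andbT /=.
  by case: (a == x); rewrite ?mul0r ?mul1r.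
rewrite finc_unitE // inE; case: (w == y) => //.
by rewrite andbF mul0r eqxx.
Qed.

Lemma inc_corner i x y : finc_e K x ** i ** finc_e K y = i x y *: finc_val (finc_unit x y).
Proof.
apply: incidence_ext => a b; rewrite inc_mul_er inc_mul_el incidenceZE /=.
have [->|_] := eqVneq a x; last by rewrite !mul0r !andbF mulr0.
have [->|_] := eqVneq b y; last by rewrite !mulr0 !andbF mulr0.
rewrite mul1r mulr1 !andbT; have [_|/incidenceP ->] := boolP (x <= y)%O.
  by rewrite mulr1.
by rewrite mul0r.
Qed.

Lemma finc_corner f x y : finc_e K x * f * finc_e K y = f x y *: finc_unit x y.
Proof. by apply: val_inj; apply: inc_corner. Qed.

Lemma finc_corner_diag f x : finc_e K x * f * finc_e K x = f x x *: finc_e K x.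
Proof. by rewrite finc_corner finc_unit_diag. Qed.

(** An incidence function commuting with all matrix units is a scalar multiple
    of the unity: its off-diagonal entries vanish, and its diagonal entries at
    comparable points agree. *)
Lemma inc_central (x0 : X) i : connected_poset X ->
  (forall f : finc X K, f ** i = i ** f) ->
  i = i x0 x0 *: finc_val (1 : finc X K).
Proof.
move=> conX ci; apply: incidence_ext => a b; rewrite incidenceZE finc1E.
have [<-|ab] := eqVneq a b; last first.
  have /(congr1 (fun j : incidence X K => j a b)) := ci (finc_e K a).
  by rewrite inc_mul_el inc_mul_er eqxx eq_sym (negPf ab) mul1r !mulr0.
have step u v : (u <= v)%O -> i u u = i v v.
  move=> uv; have /(congr1 (fun j : incidence X K => j u v)) := ci (finc_unit u v).
  rewrite !inc_mulE (@convE _ _ _ _ _ _ _ [:: v]) // => [|w]; last first.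
    rewrite finc_unitE // inE; case: (w == v) => //.
    by rewrite andbF mul0r eqxx.
  rewrite (@convE _ _ _ _ _ _ _ [:: u]) // => [|w]; last first.
    rewrite finc_unitE // inE; case: (w == u) => //.
    by rewrite mulr0 eqxx.
  by rewrite !big_seq1 !finc_unitE // !eqxx mul1r mulr1.
rewrite mulr1.
have [s + <-] := conX a x0.
elim: s a => //= c s IHs a /andP[+ /IHs <-] => /orP[] /step //.
Qed.

(** The diagonal of an idempotent consists of 0 and 1; if it vanishes then the
    idempotent is 0, as a nonzero entry at a pair could be split into two
    nonzero entries at strictly shorter pairs, indefinitely. *)
Lemma finc_idem_diag0 p : p * p = p -> (forall x, p x x = 0) -> p = 0.
Proof.
move=> pp p0; apply: finc_ext => x y; apply/eqP; apply: contraT => pxy.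
have split_p z : p x z != 0 -> exists2 w, p x w != 0 & (w < z)%O.
  rewrite -{1}pp finc_mulE => /inc_mul_neq0[w [pxw pwz xw wz]].
  exists w => //; rewrite lt_neqAle wz andbT; apply: contraNneq pwz => ->.
  by rewrite p0.
pose nxt z := xget z [set w | p x w != 0 /\ (w < z)%O].
have nxtP z : p x z != 0 -> p x (nxt z) != 0 /\ (nxt z < z)%O.
  by case/split_p => w pw wz; rewrite /nxt; case: xgetP => [_ -> //|/(_ w)/not_andP[]].
pose c n := iter n nxt y.
have pc n : p x (c n) != 0 by elim: n => //= n /nxtP[].
have c_lt m n : (m < n)%N -> (c n < c m)%O.
  elim: n => // n IHn; rewrite ltnS leq_eqVlt => /predU1P[->|/IHn].
    by case: (nxtP _ (pc n)).
  by apply: lt_trans; case: (nxtP _ (pc n)).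
have c_inj : injective c.
  by move=> m n cmn; case: (ltngtP m n) => // /c_lt; rewrite cmn ltxx.
have cy n : (c n <= y)%O by case: n => // n; apply/ltW/(c_lt 0%N).
have fin_c := finite_preimage (in2W c_inj) (finc_supp_row p x y).
case: infinite_nat; apply: sub_finite_set fin_c => n _ /=.
by rewrite cy pc.
Qed.

End Entries.

Arguments finc_unit {d X} K x y.

(** * Automorphisms of the finitary incidence algebra *)

(** A set of pairs with distinct components and with finite fibres is finite
    as soon as every set [A] separates the components of the pairs over only
    finitely many first components. Otherwise infinitely many pairwise
    disjoint pairs can be chosen one after the other, and the set of their
    second components contradicts the assumption. *)
Lemma finite_pairs (T : choiceType) (B : set (T * T)) :
    (forall p, B p -> p.1 != p.2) ->
    (forall x, finite_set [set y | B (x, y)]) ->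
    (forall y, finite_set [set x | B (x, y)]) ->
    (forall A : set T, finite_set [set x | ~ A x /\ exists2 y, B (x, y) & A y]) ->
  finite_set B.
Proof.
move=> Bneq Brow Bcol Bsep; apply: contrapT => Binf.
have touch (s : seq T) : finite_set [set p | B p /\ (p.1 \in s \/ p.2 \in s)].
  elim: s => [|a s IHs].
    by apply: (@sub_finite_set _ _ set0) => // p [_ []].
  have H := finite_setUW (finite_setUW (finite_image (pair a) (Brow a))
    (finite_image (fun x => (x, a)) (Bcol a))) IHs.
  apply: sub_finite_set H => -[x y] /= [Bxy]; rewrite !inE.
  case=> /orP[/eqP E|xs]; subst; [left; left| right | left; right |right].
  - by exists y.
  - by split=> //; left.
  - by exists x.
  - by split=> //; right.
have fresh (s : seq T) : exists p, B p /\ (p.1 \notin s) && (p.2 \notin s).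
  apply: contrapT => nex; apply: Binf; apply: sub_finite_set (touch s) => p Bp.
  split=> //; apply: contrapT => /not_orP[/negP p1 /negP p2].
  by apply: nex; exists p; rewrite p1 p2.
have [next nextP] := choice fresh.
pose L := fix L n := if n is n'.+1 then
  [:: (next (L n')).1, (next (L n')).2 & L n'] else [::].
pose P n := next (L n).
have PL m n : (m < n)%N -> ((P m).1 \in L n) /\ ((P m).2 \in L n).
  elim: n => // n IHn; rewrite ltnS leq_eqVlt => /predU1P[->|/IHn[p1 p2]].
    by split; rewrite /= !inE eqxx ?orbT.
  by split; rewrite /= !inE ?p1 ?p2 !orbT.
have PB n : B (P n) by case: (nextP (L n)).
have P1n n : (P n).1 \notin L n by case: (nextP (L n)) => _ /andP[].
have P2n n : (P n).2 \notin L n by case: (nextP (L n)) => _ /andP[].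
have P1inj : injective (fun n => (P n).1).
  move=> m n /= E; case: (ltngtP m n) => // /PL[].
    by rewrite E (negPf (P1n n)).
  by rewrite -E (negPf (P1n m)).
have := finite_preimage (in2W P1inj) (Bsep [set y | exists n, y = (P n).2]).
move=> fin; apply: infinite_nat; apply: sub_finite_set fin => n _ /=; split.
  case=> m E; case: (ltngtP m n) => [|| mn].
  - by move=> /PL[_]; rewrite -E (negPf (P1n n)).
  - by move=> /PL[+ _]; rewrite E (negPf (P2n m)).
  - by move: (Bneq _ (PB n)); rewrite E mn eqxx.
by exists (P n).2; [rewrite -surjective_pairing | exists n].
Qed.

Section FincAut.
Context {d : Order.disp_t} {X : porderType d} {K : fieldType}.
Implicit Types (f g p : finc X K) (x y z : X).

(** [t] is a K-algebra automorphism of the finitary incidence algebra, with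
    inverse [t']. *)
Record finc_aut (t t' : finc X K -> finc X K) : Prop := FincAut {
  finc_autL : linear t;
  finc_autM : {morph t : f g / f * g};
  finc_autK : cancel t t';
  finc_autVK : cancel t' t }.

Section Basics.
Variables (t t' : finc X K -> finc X K).
Hypothesis aut : finc_aut t t'.

Lemma finc_autZ a f : t (a *: f) = a *: t f.
Proof. exact: linear_scale (finc_autL aut) a f. Qed.

Lemma finc_aut0 : t 0 = 0.
Proof. exact: linear_zero (finc_autL aut). Qed.

Lemma finc_aut_inv : finc_aut t' t.
Proof.
split; [| |exact: finc_autVK aut|exact: finc_autK aut].
- move=> a f g; apply: (can_inj (finc_autK aut)).
  by rewrite (finc_autL aut) !(finc_autVK aut).
- move=> f g; apply: (can_inj (finc_autK aut)).
  by rewrite (finc_autM aut) !(finc_autVK aut).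
Qed.

Lemma finc_aut_neq0 f : f != 0 -> t f != 0.
Proof.
apply: contraNneq => tf; apply/eqP.
by rewrite -(finc_autK aut f) tf -{1}finc_aut0 (finc_autK aut).
Qed.

Lemma aut_corner x f : exists c, t (finc_e K x) * f * t (finc_e K x) = c *: t (finc_e K x).
Proof.
exists (t' f x x); rewrite -finc_autZ -finc_corner_diag !(finc_autM aut).
by rewrite (finc_autVK aut).
Qed.

Lemma aut_idem x : t (finc_e K x) * t (finc_e K x) = t (finc_e K x).
Proof. by rewrite -(finc_autM aut) finc_ee. Qed.

(** [t] maps [e_x] to a rank one idempotent: if it has a nonzero diagonal
    entry, at [y], then it factors through [y]. *)
Lemma aut_through x y : t (finc_e K x) y y != 0 ->
  t (finc_e K x) * finc_e K y * t (finc_e K x) = t (finc_e K x).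
Proof.
move=> pyy; have [c Hc] := aut_corner x (finc_e K y); rewrite Hc.
have /(congr1 (fun f : finc X K => f y y)) := Hc.
have /(congr1 (fun f : finc X K => f y y)) := aut_idem x.
rewrite !finc_mulE !inc_mul_diag finc_eE eqxx mulr1 => -> E.
suff -> : c = 1 by rewrite scale1r.
by apply: (mulIf pyy); rewrite mul1r.
Qed.

Lemma aut_diag1 x y : t (finc_e K x) y y != 0 -> t (finc_e K x) y y = 1.
Proof.
move=> pyy; have /(congr1 (fun f : finc X K => f y y)) := aut_idem x.
rewrite finc_mulE inc_mul_diag => E.
by apply: (mulIf pyy); rewrite mul1r.
Qed.

Lemma aut_rank1 x y a b : t (finc_e K x) y y != 0 ->
  t (finc_e K x) a b = t (finc_e K x) a y * t (finc_e K x) y b.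
Proof. by move=> pyy; rewrite -{1}(aut_through pyy) mul_e_mulE. Qed.

Lemma aut_diag_uniq x y z :
  t (finc_e K x) y y != 0 -> t (finc_e K x) z z != 0 -> z = y.
Proof.
move=> pyy; rewrite (aut_rank1 z z pyy) mulf_eq0 negb_or => /andP[zy yz].
by apply/le_anti; rewrite (incidence_le zy) (incidence_le yz).
Qed.

Lemma aut_diag_ex x : exists y, t (finc_e K x) y y != 0.
Proof.
apply: contrapT => nex; have : t (finc_e K x) != 0.
  by apply: finc_aut_neq0; rewrite -finc_unit_diag finc_unit_neq0.
suff -> : t (finc_e K x) = 0 by rewrite eqxx.
apply: finc_idem_diag0 => [|y]; first exact: aut_idem.
by apply/eqP; apply: contrapT => /negP py; apply: nex; exists y.
Qed.

End Basics.

Lemma aut_diag_inv t t' x y : finc_aut t t' ->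
  t (finc_e K x) y y != 0 -> t' (finc_e K y) x x != 0.
Proof.
move=> aut pyy; have /(congr1 t') := aut_through aut pyy.
rewrite !(finc_autM (finc_aut_inv aut)) (finc_autK aut) => E.
have /(congr1 (fun f : finc X K => f x x)) := E.
rewrite finc_corner_diag incidenceZE !finc_eE eqxx mulr1 => ->.
exact: oner_neq0.
Qed.

Section Conjugator.
Variables (t t' : finc X K -> finc X K).
Hypothesis aut : finc_aut t t'.
Hypothesis diag : forall x, t (finc_e K x) x x != 0.

Let p x := t (finc_e K x).

Fact conjugator_inc_subproof : (fun x y => p y x y) \in @incidence_pred _ X K.
Proof. by apply/asboolP => x y /incidenceP ->. Qed.

(** If [p y x y] is nonzero then so is [e_x * t e_y], hence also
    [t' e_x * e_y]; but the row at [x] of [t' e_x] has only finitely many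
    nonzero entries below [v]. *)
Lemma conjugator_row x v : finite_set [set y | (y <= v)%O && (p y x y != 0)].
Proof.
apply: sub_finite_set (finc_supp_row (t' (finc_e K x)) x v) => y /= /andP[-> pxy] /=.
apply/eqP => q0.
have diag' : t' (finc_e K x) x x != 0 by apply: aut_diag_inv aut (diag x).
have : t' (finc_e K x) * finc_e K y = 0.
  apply: finc_ext => a b; rewrite finc_mulE inc_mul_er.
  rewrite (aut_rank1 (finc_aut_inv aut) _ _ diag').
  by case: eqVneq => [->|]; rewrite ?mulr0 // q0 mulr0 mul0r.
move=> /(congr1 t); rewrite (finc_autM aut) (finc_autVK aut) (finc_aut0 aut).
move=> /(congr1 (fun f : finc X K => f x y)).
by rewrite finc_mulE inc_mul_el eqxx mul1r => /eqP; rewrite (negPf pxy).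
Qed.

(** For a set [A] of points, the finitary function [F = t (e_A)] satisfies
    [F * p y = p y] for [y] in [A], and [F x x = 0] for [x] outside [A]; so every
    nonzero [p y x y] with [y] in [A] and [x] outside [A] produces an
    off-diagonal nonzero entry in the row of [F] at [x]. *)
Fact conjugator_finitary_subproof :
  Incidence conjugator_inc_subproof \in @finitary_pred _ X K.
Proof.
apply/asboolP => u v uv; apply: finite_pairs => [q []//|x|y|A].
- apply: sub_finite_set (conjugator_row x v) => y /= [_ _ yv _ ->].
  by rewrite yv.
- apply: sub_finite_set (finc_supp_col (p y) u y) => x /= [ux _ _ _ ->].
  by rewrite ux.
pose F := t (finc_diag (fun x => (x \in A)%:R)).
have Fp y : F * p y = (y \in A)%:R *: p y.
  rewrite -(finc_autM aut) -(finc_autZ aut); congr t; apply: finc_ext => a b.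
  rewrite finc_mulE inc_mul_diagl.
  rewrite -[RHS]/((y \in A)%:R * finc_e K y a b) finc_eE.
  by case: eqVneq => [->|]; rewrite ?mulr0.
apply: sub_finite_set (finite_image fst (fincP F uv)) => x /= [Ax [y]].
move=> [ux xy yv _ pxy Ay].
have Fx : F x x = 0.
  have /(congr1 (fun f : finc X K => f x x)) := Fp x.
  rewrite finc_mulE inc_mul_diag (memNset Ax) scale0r => /eqP.
  by rewrite mulf_eq0 (negPf (diag x)) orbF => /eqP.
have : (F * p y) x y != 0 by rewrite Fp (mem_set Ay) scale1r.
rewrite finc_mulE => /inc_mul_neq0[z [Fxz _ xz zy]].
exists (x, z) => //; split=> //=; first exact: le_trans zy yv.
by apply: contraNneq Fxz => <-; rewrite Fx.
Qed.

(** The element conjugating [e_x] to [t e_x] for every [x]: its column at [y] is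
    that of the idempotent [t e_y], so that formally it is the sum of the
    products [t e_y * e_y]. *)
Definition conjugator : finc X K := FInc conjugator_finitary_subproof.

End Conjugator.
End FincAut.

(** * The reflection along an involution of the poset *)

Section Reflection.
Context {d : Order.disp_t} {X : porderType d} {K : fieldType}.
Variable lam : poset_involution X.
Implicit Types (f g p : finc X K) (i j : incidence X K) (x y z : X).

Lemma inc_rho_mul i j : inc_rho lam (i ** j) = inc_rho lam j ** inc_rho lam i.
Proof.
apply: incidence_ext => x y; rewrite inc_mulE /conv /=.
rewrite /conv (reindex_fsbig lam [set z | (x <= z <= y)%O]).
  by apply: eq_fsbigr => z _; rewrite mulrC.
split=> [z|z w _ _ /(congr1 lam)|z] /=.
- by rewrite -!(poset_inv_anti lam) andbC.
- by rewrite !(poset_inv_invol lam).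
- rewrite [X in (X && _)](poset_inv_anti lam) [X in (_ && X)](poset_inv_anti lam).
  rewrite !(poset_inv_invol lam) andbC => zP.
  by exists (lam z); rewrite ?(poset_inv_invol lam).
Qed.

Lemma inc_rhoK : involutive (@inc_rho _ X K lam).
Proof. by move=> i; apply: incidence_ext => x y /=; rewrite !(poset_inv_invol lam). Qed.

Lemma inc_rho_linear : linear (@inc_rho _ X K lam).
Proof. by move=> a i j; apply: incidence_ext => x y. Qed.

Lemma finc_rho_mul f g : finc_rho lam (f * g) = finc_rho lam g * finc_rho lam f.
Proof. by apply: val_inj; apply: inc_rho_mul. Qed.

Lemma finc_rhoK : involutive (@finc_rho _ X K lam).
Proof. by move=> f; apply: val_inj; apply: inc_rhoK. Qed.

Lemma finc_rho_linear : linear (@finc_rho _ X K lam).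
Proof. by move=> a f g; apply: finc_ext => x y. Qed.

Lemma finc_rho_diag (c : X -> K) :
  finc_rho lam (finc_diag c) = finc_diag (fun x => c (lam x)).
Proof.
apply: finc_ext => x y /=; rewrite (inj_eq (inv_inj (poset_inv_invol lam))).
by rewrite eq_sym; case: eqVneq => // ->.
Qed.

Lemma finc_diag_ext (c e : X -> K) : c =1 e -> finc_diag c = finc_diag e.
Proof. by move=> ce; apply: finc_ext => x y /=; rewrite ce. Qed.

Lemma finc_diag1 : finc_diag (fun _ => 1) = 1 :> finc X K.
Proof. by apply: finc_ext => x y /=; case: eqP. Qed.

Lemma finc_rho_e x : finc_rho lam (finc_e K x) = finc_e K (lam x).
Proof.
rewrite finc_rho_diag; apply: finc_diag_ext => y.
by rewrite (can2_eq (poset_inv_invol lam) (poset_inv_invol lam)).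
Qed.

Lemma finc_aut_rho (t t' : finc X K -> finc X K) : finc_aut t t' ->
  finc_aut (finc_rho lam \o t \o finc_rho lam) (finc_rho lam \o t' \o finc_rho lam).
Proof.
move=> aut; split=> [a f g|f g|f|f] /=.
- by rewrite finc_rho_linear (finc_autL aut) finc_rho_linear.
- by rewrite finc_rho_mul (finc_autM aut) finc_rho_mul.
- by rewrite finc_rhoK (finc_autK aut) finc_rhoK.
- by rewrite finc_rhoK (finc_autVK aut) finc_rhoK.
Qed.

End Reflection.

(** * Automorphisms fixing the diagonal idempotents up to conjugacy are inner *)

Section Inner.
Context {d : Order.disp_t} {X : porderType d} {K : fieldType}.
Variable lam : poset_involution X.
Implicit Types (f g p : finc X K) (x y z : X).

(** The involution of the poset serves to obtain the inverse of the conjugator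
    of [t]: it is the reflection of the conjugator of the reflection of [t]. *)
Lemma aut_conj_e (t t' : finc X K -> finc X K) : finc_aut t t' ->
    (forall x, t (finc_e K x) x x != 0) ->
  exists u v, mutual_inverse u v /\ forall x, t (finc_e K x) = u * finc_e K x * v.
Proof.
move=> aut diag; have aut2 := finc_aut_rho lam aut.
have diag2 x : (finc_rho lam \o t \o finc_rho lam) (finc_e K x) x x != 0.
  by rewrite /= finc_rho_e.
pose U := conjugator aut diag; pose U' := finc_rho lam (conjugator aut2 diag2).
have UE x y : U x y = t (finc_e K y) x y by [].
have U'E x y : U' x y = t (finc_e K x) x y.
  by rewrite /= finc_rho_e !(poset_inv_invol lam).
have diag1 x : t (finc_e K x) x x = 1 by apply: (aut_diag1 aut).
have U'U : U' * U = 1.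
  apply: finc_ext => x y; rewrite finc1E.
  have -> : (U' * U) x y = (t (finc_e K x) * t (finc_e K y)) x y.
    by apply: eq_fsbigr => z _; rewrite UE U'E.
  rewrite -(finc_autM aut); have [<-|xy] := eqVneq x y.
    by rewrite finc_ee diag1.
  by rewrite finc_ee0 // (finc_aut0 aut).
have UU' : U * U' = 1.
  apply/esym/eqP; rewrite -subr_eq0; apply/eqP; apply: finc_idem_diag0 => [|x].
    rewrite mulrBl mul1r mulrBr mulr1 -mulrA (mulrA U') U'U mul1r.
    by rewrite subrr subr0.
  rewrite -[LHS]/((1 : finc X K) x x - (U * U') x x).
  by rewrite finc_mulE inc_mul_diag UE U'E diag1 mulr1 finc1E eqxx subrr.
exists U, U'; split=> // x; apply: finc_ext => a b.
by rewrite mul_e_mulE UE U'E; exact: (aut_rank1 aut a b (diag x)).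
Qed.

Hypothesis mult_inner : forall s : incidence X K,
  multiplicative_weight s -> inner_automorphism (mult_aut s).

Lemma finc_aut_inner (t t' : finc X K -> finc X K) : finc_aut t t' ->
  (forall x, t (finc_e K x) x x != 0) -> inner_automorphism t.
Proof.
move=> aut diag; have [u [v [[uv vu] te]]] := aut_conj_e aut diag.
pose t1 f := v * t f * u.
have t1M f g : t1 (f * g) = t1 f * t1 g.
  by rewrite /t1 (finc_autM aut) (conjM _ _ uv).
have t1Z a f : t1 (a *: f) = a *: t1 f.
  by rewrite /t1 (finc_autZ aut) -finc_scalerAr -finc_scalerAl.
have t1e x : t1 (finc_e K x) = finc_e K x.
  by rewrite /t1 te conjK.
have s_inc : (fun x y => t1 (finc_unit K x y) x y) \in @incidence_pred _ X K.
  by apply/asboolP => x y /incidenceP ->.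
pose s := Incidence s_inc.
have t1E f x y : t1 f x y = s x y * f x y.
  have := congr1 t1 (finc_corner f x y); rewrite !t1M !t1e t1Z finc_corner.
  have [xy|xy _] := boolP (x <= y)%O; last by rewrite !incidenceP ?mulr0.
  move=> /(congr1 (fun f : finc X K => f x y)).
  rewrite -[_ x y]/(t1 f x y * finc_unit K x y x y) finc_unitE // !eqxx mulr1.
  by rewrite mulrC.
have t1u x y : t1 (finc_unit K x y) = s x y *: finc_unit K x y.
  apply: finc_ext => a b; rewrite t1E.
  rewrite -[RHS]/(s x y * finc_unit K x y a b) /=.
  by case: eqVneq => [->|]; case: eqVneq => [->|]; rewrite ?andbF ?mulr0.
have ws : multiplicative_weight s.
  split=> [x y xy|x y z xy yz].
    apply: contra (finc_aut_neq0 aut (finc_unit_neq0 (K := K) xy)) => /eqP s0.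
    have := t1u x y; rewrite s0 scale0r => /(congr1 (fun f => u * f * v)).
    by rewrite conjK // mulr0 mul0r => ->.
  have := t1M (finc_unit K x y) (finc_unit K y z).
  rewrite finc_unitM // !t1u -finc_scalerAl -finc_scalerAr finc_unitM // scalerA.
  move=> /(congr1 (fun f : finc X K => f x z)).
  rewrite -[X in X = _]/(s x z * finc_unit K x z x z).
  rewrite -[X in _ = X]/(s x y * s y z * finc_unit K x z x z).
  by rewrite finc_unitE ?(le_trans xy yz) // !eqxx !mulr1.
(* t1 is the multiplicative automorphism of weight s *)
have [u0 [v0 [[uv0 vu0] Ms]]] := mult_inner ws.
exists (u * u0), (v0 * v); split; first exact: mutual_inverse_mul.
move=> f; have <- : u * t1 f * v = t f by apply: conjK.
have -> : t1 f = mult_aut s f by apply: finc_ext => x y; rewrite t1E.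
by rewrite Ms !mulrA.
Qed.

End Inner.

(** * The two reflections of the finitary incidence algebra are not equivalent *)

Section Pullback.
Context {d : Order.disp_t} {X : porderType d} {K : fieldType}.
Variables al be : X -> X.
Hypothesis al_le : forall x y, (x <= y)%O = (al x <= al y)%O.
Hypothesis alK : cancel al be.
Implicit Types (f g : finc X K) (x y z : X).

Fact pull_inc_subproof f : (fun x y => f (al x) (al y)) \in @incidence_pred _ X K.
Proof. by apply/asboolP => x y; rewrite al_le => /(incidenceP f). Qed.

Fact pull_finitary_subproof f :
  Incidence (pull_inc_subproof f) \in @finitary_pred _ X K.
Proof.
apply/asboolP => x y; rewrite al_le => /(fincP f) H.
apply: sub_finite_set (finite_image (fun p : X * X => (be p.1, be p.2)) H).
move=> [u v] /= [xu uv vy neuv f0]; exists (al u, al v); last by rewrite /= !alK.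
by split; rewrite /= -?al_le // (can_eq alK).
Qed.

(** The automorphism induced by an automorphism of the poset. *)
Definition finc_pull f : finc X K := FInc (pull_finitary_subproof f).

Lemma finc_pull_mul : cancel be al -> {morph finc_pull : f g / f * g}.
Proof.
move=> beK f g; apply: finc_ext => x y.
rewrite /= /conv (reindex_fsbig al [set z | (x <= z <= y)%O]) //.
split=> [z|z w _ _ /(can_inj alK)//|z] /=; first by rewrite -!al_le.
by move=> zP; exists (be z); rewrite /= ?beK // (al_le x) (al_le _ y) beK.
Qed.

End Pullback.

Lemma twisted_comm (A : pzRingType) (u v w ru rv f : A) :
    v * u = 1 -> w * w = 1 -> ru * rv = 1 ->
  u * f * v = w * (rv * f * ru) * w -> f * (ru * w * u) = ru * w * u * f.
Proof.
move=> vu ww rr /(congr1 (fun g => ru * w * g * u)).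
by rewrite !mulrA -!(mulrA _ w w) ww mulr1 rr mul1r -!(mulrA _ v u) vu mulr1 => <-.
Qed.

Section NotEquivalent.
Context {d : Order.disp_t} {X : porderType d} {K : fieldType}.
Implicit Types (f g : finc X K) (x y z : X).

Lemma finc_aut_pull (al be : X -> X)
    (al_le : forall x y, (x <= y)%O = (al x <= al y)%O)
    (be_le : forall x y, (x <= y)%O = (be x <= be y)%O)
    (alK : cancel al be) (beK : cancel be al) :
  finc_aut (finc_pull (K := K) al_le alK) (finc_pull (K := K) be_le beK).
Proof.
split=> [a f g|||].
- exact: finc_ext.
- exact: finc_pull_mul.
- by move=> f; apply: finc_ext => x y /=; rewrite !beK.
- by move=> f; apply: finc_ext => x y /=; rewrite !alK.
Qed.

(** Every automorphism permutes the idempotents [e_x] up to conjugacy, along an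
    automorphism of the poset; the order is recovered from the fact that
    [e_x FI e_y] is nonzero exactly when [x <= y]. *)
Lemma aut_poset (t t' : finc X K -> finc X K) : finc_aut t t' ->
  exists al be : X -> X, [/\ cancel al be, cancel be al,
    forall x y, (x <= y)%O = (al x <= al y)%O,
    forall x y, (x <= y)%O = (be x <= be y)%O &
    forall x, t (finc_e K x) (al x) (al x) != 0].
Proof.
have mono s s' (al : X -> X) x y : finc_aut s s' ->
    (forall x, s (finc_e K x) (al x) (al x) != 0) ->
    (x <= y)%O -> (al x <= al y)%O.
  move=> saut sal xy; apply: contraT => alxy.
  have /eqP[] := finc_aut_neq0 saut (finc_unit_neq0 (K := K) xy).
  rewrite -e_mul_unit -unit_mul_e !(finc_autM saut).
  rewrite -(aut_through saut (sal x)) -(aut_through saut (sal y)).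
  set p := s (finc_e K x); set q := s (finc_e K y); set r := s (finc_unit K x y).
  have -> : p * finc_e K (al x) * p * (r * (q * finc_e K (al y) * q)) =
      p * (finc_e K (al x) * (p * r * q) * finc_e K (al y)) * q.
    by rewrite !mulrA.
  by rewrite finc_corner incidenceP // scale0r mulr0 mul0r.
move=> aut; have aut' := finc_aut_inv aut.
have [al alP] := choice (aut_diag_ex aut).
have [be beP] := choice (aut_diag_ex aut').
have alK : cancel al be.
  by move=> x; apply: (aut_diag_uniq aut' (aut_diag_inv aut (alP x)) (beP _)).
have beK : cancel be al.
  by move=> x; apply: (aut_diag_uniq aut (aut_diag_inv aut' (beP x)) (alP _)).
have al_le x y : (x <= y)%O = (al x <= al y)%O.
  apply/idP/idP => [|/(mono _ _ be _ _ aut' beP)]; first exact: mono aut alP.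
  by rewrite !alK.
exists al, be; split=> // x y.
by rewrite [RHS]al_le !beK.
Qed.

Variables (lam : poset_involution X) (X1 X2 : set X).
Hypothesis partX : adapted_partition lam X1 X2.

Lemma part_lam x : (lam x \in X1) = (x \notin X1).
Proof.
case: partX => -[XU XI] [l12 l21] _ _; apply/idP/idP.
  rewrite inE => lx; apply/negP; rewrite inE => x1.
  have : (X1 `&` X2) (lam x) by split=> //; rewrite -l12; exists x.
  by rewrite XI.
move=> /negP; rewrite !inE => nx.
have : (X1 `|` X2) x by rewrite XU.
by case=> // x2; rewrite -l21; exists x.
Qed.

Hypothesis charK : 2%N \notin [pchar K].

Lemma char_two : (2%:R : K) != 0.
Proof. by move: charK; rewrite inE. Qed.

Lemma opp_eq0 (a : K) : a = - a -> a = 0.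
Proof.
move/eqP; rewrite -subr_eq0 opprK -mulr2n -mulr_natr mulf_eq0 (negPf char_two).
by rewrite orbF => /eqP.
Qed.

Lemma finc_wE x : finc_w K X1 x x = if x \in X1 then 1 else -1.
Proof. by rewrite /= eqxx. Qed.

Lemma finc_w_lam x : finc_w K X1 (lam x) (lam x) = - finc_w K X1 x x.
Proof. by rewrite !finc_wE part_lam; case: (x \in X1); rewrite ?opprK. Qed.

Hypothesis conX : connected_poset X.
Hypothesis mult_inner : forall s : incidence X K,
  multiplicative_weight s -> inner_automorphism (mult_aut s).

(** Were the two reflections conjugate under an automorphism, that automorphism
    could be taken to be inner, by [u]; then [rho u * w * u] is central, hence
    scalar, whereas its diagonal entries at [x] and [lam x] are opposite. *)
Lemma finc_rho_sigma_not_equivalent (x0 : X) (t t' : finc X K -> finc X K) :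
  finc_aut t t' ->
  ~ (forall f, t (finc_rho lam f) = finc_w K X1 * finc_rho lam (t f) * finc_w K X1).
Proof.
set w := finc_w K X1 => aut trho.
have [al [be [alK beK al_le be_le alP]]] := aut_poset aut.
(* t (e_(lam x)) is w * rho (t e_x) * w, whose nonzero diagonal entry lies at
   lam (al x) *)
have lamal x : al (lam x) = lam (al x).
  apply/esym/(aut_diag_uniq aut (alP (lam x))).
  rewrite -finc_rho_e trho finc_mulE inc_mul_diag finc_val_mul inc_mul_diag.
  rewrite mulrAC -inc_mul_diag -finc_mulE finc_wM finc1E eqxx mul1r /=.
  by rewrite (poset_inv_invol lam).
(* A commutes with the reflections, and t \o A fixes the e_x up to
   conjugacy *)
pose A := finc_pull (K := K) al_le alK.
have autA : finc_aut A _ := finc_aut_pull al_le be_le alK beK.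
pose t1 := t \o A; pose t1' := finc_pull (K := K) be_le beK \o t'.
have aut1 : finc_aut t1 t1'.
  split=> [a f g|f g|f|f].
  - by rewrite /t1 /= (finc_autL autA) (finc_autL aut).
  - by rewrite /t1 /= (finc_autM autA) (finc_autM aut).
  - by rewrite /t1 /t1' /= (finc_autK aut) (finc_autK autA).
  - by rewrite /t1 /t1' /= (finc_autVK autA) (finc_autVK aut).
have A_e x : A (finc_e K (al x)) = finc_e K x.
  by apply: finc_ext => a b; rewrite finc_eE -[LHS]/(finc_e K (al x) (al a) (al b))
    finc_eE !(can_eq alK).
have diag1 x : t1 (finc_e K x) x x != 0.
  by rewrite -{1}(beK x) /t1 /= A_e -{2 3}(beK x) alP.
have Arho f : A (finc_rho lam f) = finc_rho lam (A f).
  by apply: finc_ext => x y /=; rewrite !lamal.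
have t1rho f : t1 (finc_rho lam f) = w * finc_rho lam (t1 f) * w.
  by rewrite /t1 /= Arho trho.
have [u [v [[uv vu] tu]]] := finc_aut_inner lam mult_inner aut1 diag1.
have ww : w * w = 1 by apply: finc_wM.
have rvu : finc_rho lam u * finc_rho lam v = 1.
  rewrite -finc_rho_mul vu -finc_diag1 finc_rho_diag.
  exact: finc_diag_ext.
pose z : finc X K := finc_rho lam u * w * u.
have zc f : f * z = z * f.
  apply: (twisted_comm vu ww rvu).
  have := t1rho (finc_rho lam f).
  by rewrite !tu !finc_rhoK !finc_rho_mul finc_rhoK (mulrA (finc_rho lam v)).
have zE := inc_central x0 conX (fun f => congr1 (@finc_val _ X K) (zc f)).
have zx x : z x x = u (lam x) (lam x) * w x x * u x x.
  by rewrite finc_mulE inc_mul_diag finc_val_mul inc_mul_diag.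
have z0 : z x0 x0 = 0.
  apply: opp_eq0; have : z (lam x0) (lam x0) = z x0 x0.
    by rewrite zE !incidenceZE !finc1E !eqxx !mulr1.
  move=> {1}<-; rewrite !zx (poset_inv_invol lam) finc_w_lam mulrN mulNr.
  by rewrite mulrAC [in RHS]mulrAC (mulrC (u x0 x0)).
have ux x : u x x != 0.
  have /(congr1 (fun f : finc X K => f x x)) := uv.
  rewrite finc_mulE inc_mul_diag finc1E eqxx => uvx.
  by apply: contra_eq_neq uvx => ->; rewrite mul0r eq_sym oner_eq0.
move/eqP: z0; rewrite zx !mulf_eq0 !(negPf (ux _)) orbF /w finc_wE.
by case: ifP; rewrite ?oppr_eq0 oner_eq0.
Qed.

End NotEquivalent.

(** * Automorphisms of the idealization *)

(** Conjugation by [1 + J] removes the inner derivation [F * J - J * F]. *)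
Lemma conj_unipotent (A : pzRingType) (F J : A) : J * J = 0 -> J * F * J = 0 ->
  (1 + J) * (F + (F * J - J * F)) * (1 - J) = F.
Proof.
move=> JJ JFJ; have -> : (1 + J) * (F + (F * J - J * F)) = F * (1 + J).
  rewrite !mulrDr !mulrDl !mul1r !mulrN !mulrA JFJ JJ mul0r oppr0 !addr0.
  by rewrite mulr1 addrA addrAC addrK.
by rewrite -mulrA mulrBr mulr1 mulrDl mul1r JJ addr0 addrK mulr1.
Qed.

Section Idealization.
Context {d : Order.disp_t} {X : porderType d} {K : fieldType}.
Local Notation D := (idealization X K).
Implicit Types (f g : finc X K) (i j : incidence X K) (a b : D) (x y z : X).

Lemma inc_mulf0 f : f ** (0 : incidence X K) = 0.
Proof.
apply: (addrI (f ** (0 : incidence X K))).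
by rewrite -(inc_mulDr (conv_finl _ _) (conv_finl _ _)) !addr0.
Qed.

Lemma inc_mul0f f : (0 : incidence X K) ** f = 0.
Proof.
apply: (addrI ((0 : incidence X K) ** f)).
by rewrite -(inc_mulDl (conv_finr _ _) (conv_finr _ _)) !addr0.
Qed.

Lemma inc_mul0i i : finc_val (0 : finc X K) ** i = 0.
Proof. by apply: incidence_ext => x y; apply: fsbig1 => z _; rewrite mul0r. Qed.

Lemma inc_muli0 i : i ** finc_val (0 : finc X K) = 0.
Proof. by apply: incidence_ext => x y; apply: fsbig1 => z _; rewrite mulr0. Qed.

(** The embeddings of the two summands of the idealization. *)
Definition inF f : D := (f, 0).
Definition inI i : D := (0, i).

Lemma inF_inI a : a = inF a.1 + inI a.2.
Proof.
apply: ideal_ext; first by rewrite -[RHS]/(a.1 + 0) addr0.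
by rewrite -[RHS]/(0 + a.2) add0r.
Qed.

Lemma inF_mul f g : inF f * inF g = inF (f * g).
Proof.
apply: ideal_ext => //; rewrite -[LHS]/(f ** 0 + 0 ** g).
by rewrite inc_mulf0 inc_mul0f addr0.
Qed.

Lemma inF_inI_mul f i : inF f * inI i = inI (f ** i).
Proof.
apply: ideal_ext; first exact: mulr0.
by rewrite -[LHS]/(f ** i + 0 ** finc_val 0) inc_mul0f addr0.
Qed.

Lemma inI_inF_mul f i : inI i * inF f = inI (i ** f).
Proof.
apply: ideal_ext; first exact: mul0r.
by rewrite -[LHS]/(finc_val 0 ** 0 + i ** f) inc_mulf0 add0r.
Qed.

Lemma inI_mul i j : inI i * inI j = 0.
Proof.
apply: ideal_ext; first exact: mul0r.
by rewrite -[LHS]/(finc_val 0 ** j + i ** finc_val 0) inc_mul0i inc_muli0 addr0.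
Qed.

Lemma inF_linear : linear inF.
Proof.
move=> c f g; apply: ideal_ext => //.
by rewrite -[RHS]/(c *: (0 : incidence X K) + 0) scaler0 addr0.
Qed.

Lemma inI_linear : linear inI.
Proof.
move=> c i j; apply: ideal_ext => //.
by rewrite -[RHS]/(c *: (0 : finc X K) + 0) scaler0 addr0.
Qed.

Lemma inF1 : inF 1 = 1. Proof. by []. Qed.
Lemma inID i j : inI (i + j) = inI i + inI j. Proof. exact: linear_add inI_linear _ _. Qed.
Lemma inIZ c i : inI (c *: i) = c *: inI i. Proof. exact: linear_scale inI_linear _ _. Qed.
Lemma inIN i : inI (- i) = - inI i. Proof. by rewrite -!scaleN1r inIZ. Qed.

Lemma ideal_mul1 a b : (a * b).1 = a.1 * b.1. Proof. by []. Qed.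
Lemma ideal_scale1 (c : K) a : (c *: a).1 = c *: a.1. Proof. by []. Qed.
Lemma ideal_add1 a b : (a + b).1 = a.1 + b.1. Proof. by []. Qed.

(** A central element of square zero; together with 1 it spans the centre when
    the poset is connected. *)
Definition eps : D := inI (finc_val (1 : finc X K)).

Lemma eps_mul a : eps * a = inI (finc_val a.1).
Proof.
rewrite {1}(inF_inI a) mulrDr inI_inF_mul inI_mul addr0; congr inI.
exact: inc_mul1l.
Qed.

Lemma mul_eps a : a * eps = inI (finc_val a.1).
Proof.
rewrite {1}(inF_inI a) mulrDl inF_inI_mul inI_mul addr0; congr inI.
exact: inc_mul1r.
Qed.

Lemma eps_conj (u v : D) (c : K) : u * v = 1 -> u * (c *: eps) * v = c *: eps.
Proof.
move=> uv; rewrite -ideal_scalerAr -ideal_scalerAl mul_eps -eps_mul.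
by rewrite -mulrA uv mulr1.
Qed.

Lemma eps_neq0 (x0 : X) : eps != 0.
Proof.
apply/eqP => /(congr1 (fun a : D => a.2 x0 x0)) /eqP.
by rewrite /= eqxx oner_eq0.
Qed.

Lemma ideal_central (x0 : X) a : connected_poset X -> (forall b, b * a = a * b) ->
  exists c e, a = c *: inF 1 + e *: eps.
Proof.
move=> conX Ca; exists (a.1 x0 x0), (a.2 x0 x0).
rewrite [LHS]inF_inI -(linear_scale inF_linear) -inIZ; congr (inF _ + inI _).
  apply: val_inj; apply: (inc_central _ conX) => g.
  by have /(congr1 (fun b : D => finc_val b.1)) := Ca (inF g).
apply: (inc_central _ conX) => g.
have : g ** a.2 + (0 : incidence X K) ** a.1 =
    a.1 ** (0 : incidence X K) + a.2 ** g := congr1 snd (Ca (inF g)).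
by rewrite inc_mulf0 inc_mul0f addr0 add0r.
Qed.

Lemma central_fst c e : (c *: inF 1 + e *: eps).1 = c *: (inF 1).1.
Proof. by rewrite ideal_add1 !ideal_scale1 -[eps.1]/(0 : finc X K) scaler0 addr0. Qed.

(** [P] is a K-algebra automorphism of the idealization, with inverse [P']. *)
Record ideal_aut (P P' : D -> D) : Prop := IdealAut {
  ideal_autL : linear P;
  ideal_autM : {morph P : a b / a * b};
  ideal_autK : cancel P P';
  ideal_autVK : cancel P' P }.

Lemma ideal_aut_inv P P' : ideal_aut P P' -> ideal_aut P' P.
Proof.
case=> PL PM PK PVK; split=> // [c a b|a b]; apply: (can_inj PK).
  by rewrite PL !PVK.
by rewrite PM !PVK.
Qed.

Lemma automorphism_aut P : automorphism P -> exists P', ideal_aut P P'.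
Proof. by case=> PL [_ PM] [P' PK PVK]; exists P'. Qed.

Lemma inner_automorphism_automorphism (u v : D) :
  mutual_inverse u v -> automorphism (fun a => u * a * v).
Proof.
move=> [uv vu]; split=> [c a b||].
- by rewrite mulrDr mulrDl -ideal_scalerAr -ideal_scalerAl.
- by split=> [|a b]; rewrite ?mulr1 // conjM.
- by exists (fun a => v * a * u) => a; apply: conjK.
Qed.

Variable x0 : X.
Hypothesis conX : connected_poset X.

Section IdealAut.
Variables (P P' : D -> D).
Hypothesis aut : ideal_aut P P'.

Lemma ideal_aut_neq0 a : a != 0 -> P a != 0.
Proof.
apply: contraNneq => Pa; rewrite -(ideal_autK aut a) Pa.
by rewrite (linear_zero (ideal_autL (ideal_aut_inv aut))).
Qed.

(** The image of [eps] is central of square zero. *)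
Lemma ideal_aut_eps : exists2 e : K, e != 0 & P eps = e *: eps.
Proof.
have [b|c [e Pe]] := @ideal_central x0 (P eps) conX.
  by rewrite -(ideal_autVK aut b) -!(ideal_autM aut) eps_mul mul_eps.
have c0 : c = 0.
  have := ideal_autM aut eps eps.
  rewrite inI_mul (linear_zero (ideal_autL aut)) Pe.
  move=> /(congr1 (fun a : D => a.1 x0 x0)).
  rewrite ideal_mul1 finc_mulE inc_mul_diag central_fst incidenceZE finc1E eqxx mulr1.
  by move/esym/eqP; rewrite mulf_eq0 orbb => /eqP.
rewrite c0 scale0r add0r in Pe; exists e => //.
by apply: contraNneq (ideal_aut_neq0 (eps_neq0 x0)) => e0; rewrite Pe e0 scale0r.
Qed.

(** The second summand, being the annihilator of [eps], is preserved. *)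
Lemma ideal_aut_inI i : (P (inI i)).1 = 0.
Proof.
have [e e0 Pe] := ideal_aut_eps.
have := ideal_autM aut (inI i) eps.
rewrite inI_mul (linear_zero (ideal_autL aut)) Pe -ideal_scalerAr mul_eps -inIZ.
move=> /(congr1 (fun a : D => a.2)) /esym /= E.
apply: val_inj => /=; rewrite -[LHS]scale1r -(mulVf e0) -scalerA.
by rewrite E scaler0.
Qed.

End IdealAut.

(** The automorphism of the finitary incidence algebra induced by [P]. *)
Definition ideal_aut_fst (P : D -> D) f := (P (inF f)).1.

Lemma ideal_aut_fstE P P' a : ideal_aut P P' -> (P a).1 = ideal_aut_fst P a.1.
Proof.
move=> aut; rewrite {1}(inF_inI a) (linear_add (ideal_autL aut)).
by rewrite ideal_add1 (ideal_aut_inI aut) addr0.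
Qed.

Lemma finc_aut_fst P P' : ideal_aut P P' ->
  finc_aut (ideal_aut_fst P) (ideal_aut_fst P').
Proof.
move=> aut; have aut' := ideal_aut_inv aut; split=> [c f g|f g|f|f].
- by rewrite /ideal_aut_fst inF_linear (ideal_autL aut).
- by rewrite /ideal_aut_fst -inF_mul (ideal_autM aut).
- by rewrite -(ideal_aut_fstE _ aut') (ideal_autK aut).
- by rewrite -(ideal_aut_fstE _ aut) (ideal_autVK aut).
Qed.

Hypothesis der_inner : forall D : finc X K -> incidence X K,
  derivation D -> inner_derivation D.
Hypothesis mult_inner : forall s : incidence X K,
  multiplicative_weight s -> inner_automorphism (mult_aut s).
Variable lam : poset_involution X.

(** An automorphism fixing the idempotents [e_x] up to conjugacy is, up to an
    inner automorphism, a rescaling of the second component: conjugation by a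
    unit of the first component, then by the unipotent element attached to a
    derivation, reduces it to an automorphism fixing the first component
    pointwise, which is then determined by the image of [eps]. *)
Lemma ideal_aut_inner P P' : ideal_aut P P' ->
    (forall x, (P (inF (finc_e K x))).1 x x != 0) ->
  exists u v e, mutual_inverse u v /\
    forall a, P a = u * (inF a.1 + e *: inI a.2) * v.
Proof.
move=> aut diag; have [e e0 Pe] := ideal_aut_eps aut.
have [u [v [[uv vu] tu]]] := finc_aut_inner lam mult_inner (finc_aut_fst aut) diag.
have uv' : inF u * inF v = 1 by rewrite inF_mul uv.
have vu' : inF v * inF u = 1 by rewrite inF_mul vu.
pose P1 a : D := inF v * P a * inF u.
have P1M a b : P1 (a * b) = P1 a * P1 b.
  by rewrite /P1 (ideal_autM aut) (conjM _ _ uv').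
have P1L : linear P1.
  move=> c a b; rewrite /P1 (ideal_autL aut) mulrDr mulrDl.
  by rewrite -ideal_scalerAr -ideal_scalerAl.
have P11 f : (P1 (inF f)).1 = f.
  by rewrite !ideal_mul1 (ideal_aut_fstE _ aut) tu conjK.
have P1E f : P1 (inF f) = inF f + inI (P1 (inF f)).2.
  by rewrite {1}(inF_inI (P1 (inF f))) P11.
(* P1 (inF f) = inF f + inI (D f) for a derivation D *)
have [j Dj] : inner_derivation (fun f => (P1 (inF f)).2).
  apply: der_inner; split=> [c f g|f g]; first by rewrite inF_linear P1L.
  by rewrite -inF_mul P1M -[LHS]/(_ ** _ + _ ** _) !P11 addrC.
have jN : (1 + inI j) * (1 - inI j) = 1.
  by rewrite mulrBr mulr1 mulrDl mul1r inI_mul addr0 addrK.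
have Nj : (1 - inI j) * (1 + inI j) = 1.
  by rewrite mulrDr mulr1 mulrBl mul1r inI_mul subr0 subrK.
pose s := (1 + inI j) * inF v; pose t := inF u * (1 - inI j).
have st : s * t = 1 by apply: invM.
have ts : t * s = 1 by apply: invM.
pose P2 a : D := s * P a * t.
have P2P1 a : P2 a = (1 + inI j) * P1 a * (1 - inI j).
  by rewrite /P2 /P1 /s /t; move: (P a) (1 - _) (1 + _) => b k l; rewrite !mulrA.
have P2M a b : P2 (a * b) = P2 a * P2 b by rewrite /P2 (ideal_autM aut) (conjM _ _ ts).
have P2L : linear P2.
  move=> c a b; rewrite /P2 (ideal_autL aut) mulrDr mulrDl.
  by rewrite -ideal_scalerAr -ideal_scalerAl.
have P2_inF f : P2 (inF f) = inF f.
  rewrite P2P1 P1E Dj inID inIN -inF_inI_mul -inI_inF_mul conj_unipotent ?inI_mul //.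
  by rewrite inI_inF_mul inI_mul.
have P2_eps : P2 eps = e *: eps by rewrite /P2 Pe eps_conj.
have P2_inI i : P2 (inI i) = e *: inI i.
  have corner x y (l : incidence X K) :
      inF (finc_e K x) * inI l * inF (finc_e K y) = l x y *: (inF (finc_unit K x y) * eps).
    rewrite mul_eps inF_inI_mul inI_inF_mul -inIZ; congr inI.
    exact: inc_corner.
  have P2_1 : (P2 (inI i)).1 = 0.
    by rewrite !ideal_mul1 (ideal_aut_inI aut) mulr0 mul0r.
  rewrite (inF_inI (P2 (inI i))) P2_1 add0r -inIZ; congr inI.
  apply: incidence_ext => x y.
  have [xy|xy] := boolP (x <= y)%O; last by rewrite !incidenceP.
  have := congr1 P2 (corner x y i).
  rewrite !P2M !P2_inF (inF_inI (P2 (inI i))) P2_1 add0r corner.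
  rewrite (linear_scale P2L) P2M P2_inF P2_eps -ideal_scalerAr mul_eps.
  rewrite -!inIZ => /(congr1 (fun a : D => a.2 x y)) /=.
  by rewrite xy !eqxx /= !mulr1 mulrC.
exists t, s, e; split=> // a.
have <- : t * P2 a * s = P a by apply: conjK.
by rewrite {1}(inF_inI a) (linear_add P2L) P2_inF P2_inI.
Qed.

End Idealization.

(** * Involutions on the idealization *)

(** A symmetric unit [U] of a triangular ring, for an anti-automorphism
    exchanging the two diagonal blocks [P] and [Q], is [V * V^*] for the [V]
    below, where [B] is half of the off-diagonal block [P * U * Q]. *)
Lemma triangular_square (A : pzRingType) (P Q U B : A) :
    P * P = P -> Q * Q = Q -> P * Q = 0 -> P + Q = 1 ->
    (forall a, Q * a * P = 0) -> P * B = B -> B * Q = B -> B + B = P * U * Q ->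
  (P + B + Q * U * Q) * (Q + B + P * U * P) = U.
Proof.
move=> PP QQ PQ PQ1 QaP PB BQ BB.
have QP : Q * P = 0 by rewrite -(mulr1 Q) QaP.
have BP : B * P = 0 by rewrite -BQ -mulrA QP mulr0.
have QB : Q * B = 0 by rewrite -PB mulrA QP mul0r.
have BxB : B * B = 0 by rewrite -{1}BQ -mulrA QB mulr0.
have UE : U = P * U * P + (B + B) + Q * U * Q.
  by rewrite BB -[LHS]mulr1 -[LHS]mul1r -PQ1 !mulrDl !mulrDr !mulrA QaP add0r.
rewrite [RHS]UE.
have PA : P * (P * U * P) = P * U * P by rewrite !mulrA PP.
have BA : B * (P * U * P) = 0 by rewrite !mulrA BP !mul0r.
have CQ : Q * U * Q * Q = Q * U * Q by rewrite -!mulrA QQ.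
have CB : Q * U * Q * B = 0 by rewrite -mulrA QB mulr0.
have CA : Q * U * Q * (P * U * P) = 0 by rewrite -mulrA !(mulrA Q) QP !mul0r mulr0.
rewrite !mulrDl !mulrDr PQ PB PA BQ BxB BA CQ CB CA !addr0 add0r.
by rewrite (addrC B) -(addrA (P * U * P)).
Qed.

(** The factor [V] of the preceding lemma is invertible as soon as [U] is. *)
Lemma triangular_inverse (A : pzRingType) (P Q U V B : A) :
    P * P = P -> Q * Q = Q -> P * Q = 0 -> P + Q = 1 ->
    (forall a, Q * a * P = 0) -> P * B = B -> B * Q = B -> mutual_inverse U V ->
  mutual_inverse (P + B + Q * U * Q) (P - B * (Q * V * Q) + Q * V * Q).
Proof.
move=> PP QQ PQ PQ1 QaP PB BQ [UV VU].
have QP : Q * P = 0 by rewrite -(mulr1 Q) QaP.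
have BP : B * P = 0 by rewrite -BQ -mulrA QP mulr0.
have QB : Q * B = 0 by rewrite -PB mulrA QP mul0r.
have BxB : B * B = 0 by rewrite -{1}BQ -mulrA QB mulr0.
have QinvQ a b : a * b = 1 -> Q * a * Q * (Q * b * Q) = Q.
  move=> ab; rewrite !mulrA -(mulrA _ Q Q) QQ.
  have -> : Q * a * Q = Q * a by rewrite -[RHS]mulr1 -PQ1 mulrDr QaP add0r.
  by rewrite -(mulrA Q) ab mulr1 QQ.
set C := Q * U * Q; set C' := Q * V * Q.
have CC' : C * C' = Q by apply: QinvQ.
have C'C : C' * C = Q by apply: QinvQ.
have QC : Q * C = C by rewrite /C !mulrA QQ.
have QC' : Q * C' = C' by rewrite /C' !mulrA QQ.
have CQ : C * Q = C by rewrite /C -mulrA QQ.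
have C'Q : C' * Q = C' by rewrite /C' -mulrA QQ.
have PC' : P * C' = 0 by rewrite -QC' mulrA PQ mul0r.
have CP : C * P = 0 by rewrite -CQ -mulrA QP mulr0.
have C'P : C' * P = 0 by rewrite -C'Q -mulrA QP mulr0.
have CB : C * B = 0 by rewrite -CQ -mulrA QB mulr0.
have C'B : C' * B = 0 by rewrite -C'Q -mulrA QB mulr0.
have PC : P * C = 0 by rewrite -QC mulrA PQ mul0r.
clearbody C C'; split.
  rewrite !mulrDl !mulrDr !mulrN !mulrA PP PB PC' BP BxB CP CB CC' !mul0r.
  by rewrite !oppr0 !addr0 !add0r -addrA addrA addrNK.
rewrite !mulrDl !mulNr !mulrDr -!mulrA PP PB PC C'P C'B C'C BQ !mulr0.
by rewrite !addr0 !add0r addrK.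
Qed.

Section Involutions.
Context {d : Order.disp_t} {X : porderType d} {K : fieldType}.
Local Notation D := (idealization X K).
Implicit Types (f g : finc X K) (i j : incidence X K) (a b : D) (x y z : X).
Implicit Types (R Phi : D -> D).

Lemma involution1 R : algebra_involution R -> R 1 = 1.
Proof.
by case=> _ RM RK; rewrite -[LHS]mulr1 -{2}(RK 1) -RM mulr1 RK.
Qed.

Lemma involution_twist R (W : D) : algebra_involution R ->
  W * W = 1 -> R W = - W -> algebra_involution (fun a => W * R a * W).
Proof.
move=> [RL RM RK] WW RW; split=> [c a b|a b|a].
- by rewrite RL mulrDr mulrDl -ideal_scalerAr -ideal_scalerAl.
- by rewrite RM conjM.
- have -> : R (W * R a * W) = W * a * W.
    by rewrite !RM RK RW !mulrN mulNr opprK mulrA.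
  exact: conjK.
Qed.

Lemma neg_tilde_linear : linear (@neg_tilde _ X K).
Proof.
move=> c a b; apply: ideal_ext => //.
by rewrite -[LHS]/(- (c *: a.2 + b.2)) opprD -scalerN.
Qed.

Lemma neg_tilde_mul : {morph @neg_tilde _ X K : a b / a * b}.
Proof.
move=> a b; apply: ideal_ext => //.
rewrite -[LHS]/(- (a.1 ** b.2 + a.2 ** b.1)).
rewrite -[RHS]/(a.1 ** (- b.2) + (- a.2) ** b.1) -!scaleN1r scalerDr.
by rewrite (inc_mulZr _ (conv_finl _ _)) (inc_mulZl _ (conv_finr _ _)).
Qed.

Lemma neg_tildeK : involutive (@neg_tilde _ X K).
Proof. by move=> a; apply: ideal_ext => //; apply: opprK. Qed.

Lemma neg_tilde_inI i : neg_tilde (inI i) = - inI i.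
Proof. by apply: ideal_ext => //; apply/esym/oppr0. Qed.

Lemma involution_neg R : algebra_involution R ->
    (forall a, R (neg_tilde a) = neg_tilde (R a)) ->
  algebra_involution (R \o neg_tilde (K := K)).
Proof.
move=> [RL RM RK] Rneg; split=> [c a b|a b|a] /=.
- by rewrite neg_tilde_linear RL.
- by rewrite neg_tilde_mul RM.
- by rewrite -Rneg neg_tildeK RK.
Qed.

Lemma rho_tilde_involution (lam : poset_involution X) :
  algebra_involution (rho_tilde (K := K) lam).
Proof.
split=> [c a b|a b|a].
- by apply: ideal_ext; [apply: finc_rho_linear | apply: inc_rho_linear].
- apply: ideal_ext; first exact: finc_rho_mul.
  rewrite -[LHS]/(inc_rho lam (a.1 ** b.2 + a.2 ** b.1)).
  by rewrite (linear_add (@inc_rho_linear _ X K lam)) !inc_rho_mul addrC.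
- by apply: ideal_ext; [apply: finc_rhoK | apply: inc_rhoK].
Qed.

Lemma rho_tilde_neg (lam : poset_involution X) a :
  rho_tilde lam (neg_tilde a) = neg_tilde (rho_tilde lam a).
Proof. by apply: ideal_ext => //; apply: incidence_ext. Qed.

Lemma rho_tilde_inF (lam : poset_involution X) f :
  rho_tilde lam (inF f) = inF (finc_rho lam f).
Proof. by apply: ideal_ext => //; apply: incidence_ext. Qed.

Lemma finc_rho1 (lam : poset_involution X) : finc_rho lam (1 : finc X K) = 1.
Proof. by rewrite -finc_diag1 finc_rho_diag. Qed.

Lemma rho_tilde_eps (lam : poset_involution X) : rho_tilde (K := K) lam eps = eps.
Proof.
apply: ideal_ext; first by apply: finc_ext.
by rewrite -[LHS]/(finc_val (finc_rho lam 1)) finc_rho1.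
Qed.

Lemma sigma_tildeE (lam : poset_involution X) (X1 : set X) :
  sigma_tilde lam X1 = fun a => inF (finc_w K X1) * rho_tilde lam a * inF (finc_w K X1).
Proof.
apply/funext => a; rewrite (inF_inI (rho_tilde lam a)) mulrDr mulrDl.
by rewrite !inF_mul inF_inI_mul inI_inF_mul [LHS]inF_inI.
Qed.

Lemma inner_equivalent Phi R (u v : D) : mutual_inverse u v ->
  (forall a, v * Phi a * u = R (v * a * u)) -> equivalent Phi R.
Proof.
case=> uv vu E; exists (fun a => v * a * u); last by move=> a /=.
exact: inner_automorphism_automorphism.
Qed.

(** An involution negating [eps] is not equivalent to one fixing it. *)
Lemma not_equivalent_neg (x0 : X) R : 2%N \notin [pchar K] -> connected_poset X ->
  linear R -> R eps = eps -> ~ equivalent R (R \o neg_tilde (K := K)).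
Proof.
move=> char2 conX RL Reps [P /automorphism_aut[P' aut] PR].
have [e e0 Pe] := ideal_aut_eps x0 conX aut.
have := PR eps; rewrite /= Reps Pe (linear_scale neg_tilde_linear) neg_tilde_inI.
rewrite -scaleN1r scalerA (linear_scale RL) Reps mulrN1.
move=> /(congr1 (fun a : D => a.2 x0 x0)) /=; rewrite eqxx !mulr1.
by move/(opp_eq0 char2)/eqP; rewrite (negPf e0).
Qed.

(** Symmetric units of a triangular idealization are norms, whence involutions
    that differ by them are equivalent. *)
Lemma symmetric_equivalent Phi R (P Q U V : D) : 2%N \notin [pchar K] ->
    algebra_involution R -> R P = Q ->
    P * P = P -> Q * Q = Q -> P * Q = 0 -> P + Q = 1 ->
    (forall a, Q * a * P = 0) -> mutual_inverse U V -> R U = U ->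
    (forall a, Phi a = U * R a * V) ->
  equivalent Phi R.
Proof.
move=> char2 [RL RM RK] RP PP QQ PQ PQ1 QaP UV RU PhiE.
have RQ : R Q = P by rewrite -RP RK.
pose B := (2%:R : K)^-1 *: (P * U * Q).
have PB : P * B = B by rewrite -ideal_scalerAr !mulrA PP.
have BQ : B * Q = B by rewrite -ideal_scalerAl -(mulrA _ Q Q) QQ.
have BB : B + B = P * U * Q.
  have half : (2%:R : K)^-1 + 2%:R^-1 = 1.
    by rewrite -[X in X + X]mulr1 -mulrDr mulVf // (char_two char2).
  by rewrite /B -scalerDl half scale1r.
have RB : R B = B by rewrite (linear_scale RL) !RM RP RQ RU mulrA.
have inv := triangular_inverse PP QQ PQ PQ1 QaP PB BQ UV.
have sq := triangular_square PP QQ PQ PQ1 QaP PB BQ BB.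
set T := P + B + Q * U * Q in inv sq; set T' := P - _ + _ in inv.
have RT : R T = Q + B + P * U * P.
  by rewrite !(linear_add RL) RP RB !RM RQ RU mulrA.
rewrite -RT in sq; case: inv => TT' T'T; case: UV => UV VU.
have R1 : R 1 = 1 by apply: involution1.
have T'U : T' * U = R T by rewrite -sq mulrA T'T mul1r.
have VT : V * T = R T'.
  have UT : U * R T' = T by rewrite -sq -mulrA -RM T'T R1 mulr1.
  by rewrite -{1}UT mulrA VU mul1r.
apply: (@inner_equivalent _ _ T T') => // a.
by rewrite PhiE !RM -VT -T'U !mulrA.
Qed.

End Involutions.

(** * Classification *)

Section Classification.
Context {d : Order.disp_t} {X : porderType d} {K : fieldType}.
Local Notation D := (idealization X K).
Implicit Types (f g : finc X K) (a b : D) (x y z : X) (R Phi : D -> D).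

Variables (x0 : X) (lam : poset_involution X).
Hypothesis char2 : 2%N \notin [pchar K].
Hypothesis conX : connected_poset X.

(** Central elements with a nonzero scalar part are invertible. *)
Lemma central_inverse (c e : K) : c != 0 ->
  mutual_inverse (c *: inF 1 + e *: eps : D) (c^-1 *: inF 1 - (c^-1 * e / c) *: eps).
Proof.
move=> c0.
have mulE (c1 e1 c2 e2 : K) : (c1 *: inF 1 + e1 *: eps) * (c2 *: inF 1 + e2 *: eps) =
    (c1 * c2) *: inF 1 + (c1 * e2 + e1 * c2) *: eps :> D.
  rewrite mulrDl !mulrDr -!ideal_scalerAl -!ideal_scalerAr !scalerA.
  by rewrite inF1 !mul1r mulr1 inI_mul scaler0 addr0 scalerDl addrA.
rewrite -scaleNr; split; rewrite mulE ?mulVf ?mulfV // scale1r inF1.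
  by rewrite mulrN !mulrA mulfV // mul1r addNr scale0r addr0.
by rewrite mulNr mulfVK // addrN scale0r addr0.
Qed.

(** An involution of the form [U * R a * U^-1] has [U] equal to [R U] up to a
    central factor; adding to [U] a multiple of [R U] makes it symmetric or
    skew, and a skew unit is symmetric for the twist of [R] by a skew [W]. *)
Lemma inner_twist_equivalent Phi R (P Q W U V : D) :
    algebra_involution R -> (forall a, (R a).1 = finc_rho lam a.1) ->
    R P = Q -> P * P = P -> Q * Q = Q -> P * Q = 0 -> P + Q = 1 ->
    (forall a, Q * a * P = 0) ->
    W * W = 1 -> R W = - W -> W * Q * W = Q ->
    mutual_inverse U V -> algebra_involution Phi ->
    (forall a, Phi a = U * R a * V) ->
  equivalent Phi R \/ equivalent Phi (fun a => W * R a * W).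
Proof.
move=> invR R1 RP PP QQ PQ PQ1 QaP WW RW WQW [UV VU] [_ _ PhiK] PhiE.
have [RL RM RK] := invR; have R_1 := involution1 invR.
have RVU : R V * R U = 1 by rewrite -RM UV R_1.
have RUV : R U * R V = 1 by rewrite -RM VU R_1.
pose z := U * R V; pose z' := R U * V.
have z'z : z' * z = 1 by rewrite /z /z' mulrA -(mulrA _ V) VU mulr1 RUV.
(* Phi being an involution, U * R V is central *)
have zaz a : z * a * z' = a.
  by rewrite -[RHS]PhiK !PhiE !RM RK /z /z' !mulrA.
have zC a : a * z = z * a by rewrite -{1}(zaz a) -mulrA z'z mulr1.
have UE : U = z * R U by rewrite /z -mulrA RVU mulr1.
have zRz : z * R z = 1 by rewrite -zC RM RK -mulrA zC -UE VU.
have [c [e zE]] := ideal_central x0 conX zC.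
have cc : c * c = 1.
  have /(congr1 (fun a : D => a.1 x0 x0)) := zRz.
  rewrite ideal_mul1 finc_mulE inc_mul_diag R1 zE central_fst.
  rewrite (linear_scale (@finc_rho_linear _ X K lam)) finc_rho1.
  by rewrite incidenceZE finc1E eqxx mulr1.
have c0 : c != 0 by apply: contra_eq_neq cc => ->; rewrite mul0r eq_sym oner_eq0.
(* c = 1 or c = -1; the scalar c + c of y = z + c is nonzero, so that
   U1 = y * R U is again a unit *)
pose U1 := U + c *: R U.
have RU1 : R U1 = c *: U1.
  rewrite /U1 (linear_add RL) (linear_scale RL) RK scalerDr scalerA cc scale1r.
  by rewrite addrC.
have c2 : c + c != 0.
  by rewrite -mulr2n -mulr_natr mulf_neq0 // (char_two char2).
have [yy' y'y] := central_inverse e c2.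
set y := (c + c) *: inF 1 + e *: eps in yy' y'y.
set y' := _ - _ in yy' y'y.
have yE : y = z + c *: inF 1.
  by rewrite zE /y scalerDl addrAC.
have yC a : a * y = y * a.
  rewrite yE mulrDr mulrDl zC -ideal_scalerAr -ideal_scalerAl.
  by rewrite inF1 mul1r mulr1.
have U1E : U1 = y * R U.
  by rewrite /U1 yE mulrDl -UE -ideal_scalerAl inF1 mul1r.
pose V1 := R V * y'.
have UV1 : mutual_inverse U1 V1.
  rewrite U1E /V1; apply: mutual_inverse_mul; split=> //.
have VE : V = R V * R z.
  have E : R V * R z * U = 1 by rewrite UE mulrA -(mulrA (R V) (R z)) zC zRz mulr1 RVU.
  by rewrite -[LHS]mul1r -E -mulrA UV mulr1.
have PhiE1 a : Phi a = U1 * R a * V1.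
  have central_conj s t : (forall b, b * s = s * b) -> s * t = 1 ->
      s * R U * R a * (R V * t) = R U * R a * R V.
    move=> sC st; have -> : s * R U * R a * (R V * t) = s * (R U * R a * R V) * t.
      by rewrite !mulrA.
    by rewrite -sC -mulrA st mulr1.
  rewrite U1E /V1 central_conj // -(central_conj z (R z)) //.
  by rewrite -UE -VE PhiE.
have : (c - 1) * (c + 1) = 0.
  by rewrite mulrDr mulr1 mulrBl mul1r cc addrA subrK subrr.
move=> /eqP; rewrite mulf_eq0 subr_eq0 addr_eq0 => /orP[] /eqP cE.
  left; apply: (symmetric_equivalent char2 invR RP PP QQ PQ PQ1 QaP UV1 _ PhiE1).
  by rewrite RU1 cE scale1r.
right; pose R2 a := W * R a * W.
have invR2 : algebra_involution R2 by apply: involution_twist.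
have UW : mutual_inverse (U1 * W) (W * V1) by apply: mutual_inverse_mul.
apply: (symmetric_equivalent char2 invR2 _ PP QQ PQ PQ1 QaP UW).
- by rewrite /R2 RP.
- rewrite /R2 RM RW RU1 cE scaleN1r mulrNN mulrA WW mul1r //.
- move=> a; rewrite PhiE1 /R2.
  by rewrite !mulrA -(mulrA U1 W W) WW mulr1 -!mulrA (mulrA W W) WW mul1r.
Qed.

(** Every involution inducing [lam] is, up to an inner automorphism, the
    reflection along [lam] or its composite with [neg_tilde]. *)
Lemma induces_inner_twist Phi :
    (forall s : incidence X K, multiplicative_weight s -> inner_automorphism (mult_aut s)) ->
    (forall E : finc X K -> incidence X K, derivation E -> inner_derivation E) ->
    algebra_involution Phi -> induces Phi lam ->
  exists U V : D, mutual_inverse U V /\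
    ((forall a, Phi a = U * rho_tilde lam a * V) \/
     (forall a, Phi a = U * rho_tilde lam (neg_tilde a) * V)).
Proof.
move=> mult_inner der_inner [PL PM PK] ind.
have [rL rM rK] := rho_tilde_involution (K := K) lam.
have aut : ideal_aut (Phi \o rho_tilde lam) (rho_tilde lam \o Phi).
  split=> [c a b|a b|a|a] /=; rewrite ?rL ?PL ?rM ?PM //.
    by rewrite PK rK.
  by rewrite rK PK.
have diag x : ((Phi \o rho_tilde lam) (inF (finc_e K x))).1 x x != 0.
  rewrite /= rho_tilde_inF finc_rho_e.
  have [u [v [_ E]]] := ind (lam x).
  have /(congr1 (fun a : D => a.1 x x)) := E.
  rewrite (poset_inv_invol lam) !ideal_mul1 !(finc_mulE, finc_val_mul) !inc_mul_diag.
  rewrite -[(finc_e K x, 0).1]/(finc_e K x) finc_eE eqxx -[(_, 0)]/(inF _) => Exx.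
  by apply: contra_eq_neq Exx => ->; rewrite mulr0 mul0r oner_eq0.
have [U [V [e [UV PE]]]] := ideal_aut_inner x0 conX der_inner mult_inner lam aut diag.
have PhiE a : Phi a = U * (inF (rho_tilde lam a).1 + e *: inI (rho_tilde lam a).2) * V.
  by rewrite -{1}(rK a) [LHS]PE.
have Peps : Phi eps = e *: eps.
  rewrite PhiE rho_tilde_eps (linear_zero inF_linear) add0r.
  by case: UV => UV _; rewrite (eps_conj _ UV).
have ee : e * e = 1.
  have := PK eps; rewrite Peps (linear_scale PL) Peps scalerA.
  by move=> /(congr1 (fun a : D => a.2 x0 x0)) /=; rewrite eqxx !mulr1.
exists U, V; split=> //.
have : (e - 1) * (e + 1) = 0.
  by rewrite mulrDr mulr1 mulrBl mul1r ee addrA subrK subrr.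
move=> /eqP; rewrite mulf_eq0 subr_eq0 addr_eq0 => /orP[] /eqP eE; [left|right] => a.
  by rewrite PhiE eE scale1r -inF_inI.
rewrite PhiE eE scaleN1r rho_tilde_neg (inF_inI (neg_tilde _)) /=.
by rewrite -inIN.
Qed.

Variables (X1 X2 : set X).
Hypothesis partX : adapted_partition lam X1 X2.

(** The idempotents of the two blocks: [X1] being a down-set, the idealization
    is block triangular, and the reflection exchanges the two blocks. *)
Definition block1 : D := inF (finc_diag (fun x => (x \in X1)%:R)).
Definition block2 : D := inF (finc_diag (fun x => (x \notin X1)%:R)).

Lemma block11 : block1 * block1 = block1.
Proof.
rewrite inF_mul finc_diagM; congr inF; apply: finc_diag_ext => x.
by case: (x \in X1); rewrite ?mulr1 ?mulr0.
Qed.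

Lemma block22 : block2 * block2 = block2.
Proof.
rewrite inF_mul finc_diagM; congr inF; apply: finc_diag_ext => x.
by case: (x \in X1); rewrite ?mulr1 ?mulr0.
Qed.

Lemma block12 : block1 * block2 = 0.
Proof.
rewrite inF_mul finc_diagM -(linear_zero inF_linear); congr inF.
apply: finc_ext => x y /=; case: eqP => // _.
by case: (x \in X1); rewrite ?mulr1 ?mulr0.
Qed.

Lemma block_sum : block1 + block2 = 1.
Proof.
rewrite -(linear_add inF_linear) -inF1; congr inF; apply: finc_ext => x y.
rewrite finc1E -[LHS]/(finc_diag _ x y + finc_diag _ x y) /=.
by case: (x == y); case: (x \in X1); rewrite ?addr0 ?add0r.
Qed.

Lemma block21 a : block2 * a * block1 = 0.
Proof.
have E i x y : ((finc_diag (fun x => (x \notin X1)%:R) ** i) **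
    finc_diag (fun x => (x \in X1)%:R)) x y = 0 :> K.
  rewrite inc_mul_diagr inc_mul_diagl.
  have [x1|/negP nx1] := boolP (x \in X1); first by rewrite !mul0r.
  have [y1|_] := boolP (y \in X1); last by rewrite mulr0.
  rewrite mulr1 mul1r; apply: incidenceP; apply/negP => xy.
  case: partX => _ _ down _; have := down _ _ (set_mem y1) xy.
  by move/mem_set/nx1.
rewrite (inF_inI a) mulrDr mulrDl !inF_mul inF_inI_mul inI_inF_mul.
rewrite -[RHS]addr0; congr (_ + _).
  rewrite -(linear_zero inF_linear); congr inF; apply: finc_ext => x y.
  exact: E.
by rewrite -(linear_zero inI_linear); congr inI; apply: incidence_ext => x y; apply: E.
Qed.

Lemma finc_rho_block1 : inF (finc_rho lam block1.1) = block2.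
Proof.
rewrite finc_rho_diag; congr inF; apply: finc_diag_ext => x.
by rewrite (part_lam partX).
Qed.

Lemma finc_rho_w : inF (finc_rho lam (finc_w K X1)) = - inF (finc_w K X1).
Proof.
rewrite finc_rho_diag -scaleN1r -(linear_scale inF_linear); congr inF.
apply: finc_ext => x y; rewrite -[RHS]/(- 1 * finc_w K X1 x y) mulN1r /= (part_lam partX).
by case: eqP => _; case: (x \in X1); rewrite ?opprK ?oppr0.
Qed.

Lemma w_block2 : inF (finc_w K X1) * block2 * inF (finc_w K X1) = block2.
Proof.
rewrite !inF_mul !finc_diagM; congr inF; apply: finc_diag_ext => x.
by case: (x \in X1); rewrite ?mulr0 ?mul0r ?mulr1 ?mulrNN ?mulr1.
Qed.

Lemma inF_ww : inF (finc_w K X1) * inF (finc_w K X1) = 1.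
Proof. by rewrite inF_mul finc_wM. Qed.

(** Involutions of the idealization whose first components are the two
    reflections of the finitary incidence algebra are not equivalent. *)
Lemma reflection_not_equivalent R R' :
    (forall s : incidence X K, multiplicative_weight s -> inner_automorphism (mult_aut s)) ->
    (forall a, (R a).1 = finc_rho lam a.1) ->
    (forall a, (R' a).1 = finc_w K X1 * finc_rho lam a.1 * finc_w K X1) ->
  ~ equivalent R R'.
Proof.
move=> mult_inner R1 R1' [P /automorphism_aut[P' aut] PR].
apply: (finc_rho_sigma_not_equivalent partX char2 conX mult_inner x0
  (finc_aut_fst x0 conX aut)) => f.
have /(congr1 fst) := PR (inF f).
by rewrite /= (ideal_aut_fstE x0 conX _ aut) R1 R1'.
Qed.

End Classification.

(** * The four involutions *)

Theorem theorem6p23 (d : Order.disp_t) (X : porderType d) (K : fieldType)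
    (lam : poset_involution X) (X1 X2 : set X)
    (charK : 2%N \notin [pchar K])
    (X_nonempty : inhabited X)
    (X_connected : connected_poset X)
    (mult_inner : forall s : incidence X K,
       multiplicative_weight s -> inner_automorphism (mult_aut s))
    (der_inner : forall D : finc X K -> incidence X K,
       derivation D -> inner_derivation D)
    (lam_free : forall x : X, lam x <> x)
    (partX : adapted_partition lam X1 X2) :
  let rho := rho_tilde (K := K) lam in
  let rho' := rho \o neg_tilde (K := K) in
  let sigma := sigma_tilde (K := K) lam X1 in
  let sigma' := sigma \o neg_tilde (K := K) in
  [/\ algebra_involution rho, algebra_involution rho',
      algebra_involution sigma & algebra_involution sigma'] /\
  [/\ ~ equivalent rho rho', ~ equivalent rho sigma & ~ equivalent rho sigma'] /\
  [/\ ~ equivalent rho' sigma, ~ equivalent rho' sigma'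
    & ~ equivalent sigma sigma'] /\
  (forall Phi : idealization X K -> idealization X K,
     algebra_involution Phi -> induces Phi lam ->
     [\/ equivalent Phi rho, equivalent Phi rho',
         equivalent Phi sigma | equivalent Phi sigma']).
Proof.
case: X_nonempty => x0 rho rho' sigma sigma'.
have inv_rho : algebra_involution rho by apply: rho_tilde_involution.
have inv_rho' : algebra_involution rho'.
  by apply: involution_neg => //; apply: rho_tilde_neg.
have ww : inF (finc_w K X1) * inF (finc_w K X1) = 1 by apply: inF_ww.
have rho_w : rho (inF (finc_w K X1)) = - inF (finc_w K X1).
  by rewrite /rho rho_tilde_inF (finc_rho_w partX).
have rho'_inF f : rho' (inF f) = inF (finc_rho lam f).
  have negl : neg_tilde (inF f) = inF f by apply: ideal_ext => //; apply: oppr0.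
  by rewrite /rho' /= negl /rho rho_tilde_inF.
have sigmaE : sigma = fun a => inF (finc_w K X1) * rho a * inF (finc_w K X1).
  exact: sigma_tildeE.
have sigma'E : sigma' = fun a => inF (finc_w K X1) * rho' a * inF (finc_w K X1).
  by rewrite /sigma' sigmaE.
have rho'_w : rho' (inF (finc_w K X1)) = - inF (finc_w K X1).
  by rewrite rho'_inF (finc_rho_w partX).
have inv_sigma : algebra_involution sigma by rewrite sigmaE; apply: involution_twist.
have inv_sigma' : algebra_involution sigma' by rewrite sigma'E; apply: involution_twist.
have rho_eps : rho eps = eps by apply: rho_tilde_eps.
have sigma_eps : sigma eps = eps.
  by rewrite sigmaE rho_eps -[eps in LHS]scale1r (eps_conj _ ww) scale1r.
have not_rho_sigma R R' : (forall a, (R a).1 = finc_rho lam a.1) ->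
    (forall a, (R' a).1 = finc_w K X1 * finc_rho lam a.1 * finc_w K X1) ->
  ~ equivalent R R'.
  exact: (reflection_not_equivalent x0 charK X_connected partX mult_inner).
split; first by split.
split; first split; [|exact: not_rho_sigma|exact: not_rho_sigma|].
  by apply: not_equivalent_neg => //; case: inv_rho.
split; first split; [exact: not_rho_sigma|exact: not_rho_sigma| |].
  by apply: not_equivalent_neg => //; case: inv_sigma.
move=> Phi invPhi indPhi.
have [U [V [UV PhiE]]] := induces_inner_twist x0 X_connected mult_inner der_inner invPhi indPhi.
have key R : algebra_involution R -> (forall f, R (inF f) = inF (finc_rho lam f)) ->
    (forall a, (R a).1 = finc_rho lam a.1) ->
    (forall a, Phi a = U * R a * V) ->
    equivalent Phi R \/
    equivalent Phi (fun a => inF (finc_w K X1) * R a * inF (finc_w K X1)).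
  move=> invR RinF R1 PhiR.
  apply: (inner_twist_equivalent x0 charK X_connected invR R1 _ (block11 X1)
    (block22 X1) (block12 X1) (block_sum X1) (block21 partX) ww _
    (w_block2 X1) UV invPhi PhiR).
    by rewrite RinF (finc_rho_block1 partX).
  by rewrite RinF (finc_rho_w partX).
case: PhiE => /key PhiE.
  have [||//|Prho|Psigma] := PhiE => //.
  - by move=> f; apply: rho_tilde_inF.
  - by apply: Or41.
  - by apply: Or43; rewrite sigmaE.
have [||//|Prho|Psigma] := PhiE => //.
- by apply: Or42.
- by apply: Or44; rewrite sigma'E.
Qed.
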